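(* (1) There exists a unique linear operator $\tilde D:\Lambda\to\Lambda$ such that $D_{n+1,n}f_n=\frac1{n+1}(\tilde Df)_{n+1}$ for all $n=0,1,\dots$ and all $f\in\Lambda$; in the basis $\{FS_\mu\}$ it is given by $\tilde D\,FS_\mu=(p_1-|\mu|)FS_\mu$, $\mu\in\mathbb Y$. (2) There exists a unique linear operator $\tilde U:\Lambda\to\Lambda$ (depending on $z,z'$) such that $U_{n,n+1}f_{n+1}=\frac1{zz'+n}(\tilde Uf)_n$ for all $n=0,1,\dots$ and all $f\in\Lambda$; in the basis $\{FS_\mu\}$ it is given by $$\tilde U\,FS_\mu=\sum_{\mu_\bullet\nearrow\mu}(z)_{\mu/\mu_\bullet}(z')_{\mu/\mu_\bullet}FS_{\mu_\bullet}+(p_1+zz'+|\mu|)FS_\mu,\qquad\mu\in\mathbb Y.$$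
   Context: $\mathbb Y$ is the set of all Young diagrams (including the empty one $\varnothing$), $\mathbb Y_n$ those with $n$ boxes, $|\lambda|$ the number of boxes. $\mu\nearrow\lambda$ (equivalently $\lambda\searrow\mu$) means $\mu\subset\lambda$ and $|\lambda|=|\mu|+1$. For a skew diagram $\theta$ and $z\in\mathbb C$, $(z)_\theta=\prod_{(i,j)\in\theta}(z+j-i)$ (product over boxes, $(i,j)$ = row $i$, column $j$). $\dim\lambda$ is the number of standard Young tableaux of shape $\lambda$ ($\dim\varnothing=1$), and $\dim(\mu,\lambda)$ is the number of chains $\mu\nearrow\cdots\nearrow\lambda$ (zero unless $\mu\subseteq\lambda$; $1$ if $\mu=\lambda$). Modified Frobenius coordinates: $\lambda=(a_1,\dots,a_d\mid b_1,\dots,b_d)$ with $d$ the number of diagonal boxes, $a_i=\lambda_i-i+\frac12$, $b_i=\lambda'_i-i+\frac12$ ($\lambda_i$, $\lambda'_i$ row and column lengths). $(z,z')$ is fixed in the principal series ($z\notin\mathbb R$, $z'=\bar z$) or complementary series ($z,z'\in(N,N+1)$ for some $N\in\mathbb Z$); then $zz'>0$. Down transition: $p^\downarrow(\nu,\lambda)=\dim\lambda/\dim\nu$ if $\lambda\nearrow\nu$, else $0$. Up transition: for $\lambda\in\mathbb Y_n$, $p^\uparrow(\lambda,\nu)=\frac{(z)_{\nu/\lambda}(z')_{\nu/\lambda}}{zz'+n}\frac{\dim\nu}{(n+1)\dim\lambda}$ if $\nu\searrow\lambda$, else 0. $C(\mathbb Y_n)$ is the space of real functions on $\mathbb Y_n$;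 $D_{n+1,n}:C(\mathbb Y_n)\to C(\mathbb Y_{n+1})$, $(D_{n+1,n}f)(\nu)=\sum_{\lambda\in\mathbb Y_n}p^\downarrow(\nu,\lambda)f(\lambda)$; $U_{n,n+1}:C(\mathbb Y_{n+1})\to C(\mathbb Y_n)$, $(U_{n,n+1}g)(\lambda)=\sum_{\nu\in\mathbb Y_{n+1}}p^\uparrow(\lambda,\nu)g(\nu)$. $\Lambda=\mathbb R[p_1,p_2,\dots]$ is the algebra of symmetric functions (power sums $p_k$, Schur functions $s_\mu$), embedded injectively into the algebra of real functions on $\mathbb Y$ by $p_k(\lambda)=\sum_{i=1}^da_i^k+(-1)^{k-1}\sum_{i=1}^db_i^k$ (so $p_1(\lambda)=|\lambda|$). For $f\in\Lambda$, $f_n$ is the restriction of the function $f(\cdot)$ to $\mathbb Y_n$. The Frobenius–Schur functions $FS_\mu\in\Lambda$ ($\mu\in\mathbb Y$) are the elements with $FS_\mu(\lambda)=n^{\downarrow m}\frac{\dim(\mu,\lambda)}{\dim\lambda}$ for all $\lambda$, where $n=|\lambda|$, $m=|\mu|$, $n^{\downarrow m}=n(n-1)\cdots(n-m+1)$; $FS_\mu-s_\mu$ has degree $<|\mu|$, and $\{FS_\mu\}$ is a basis of $\Lambda$. *)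

(* Defs.v *)
(* R : realType (the real numbers); complex numbers are
   complex R from mathcomp-real-closed. *)
From HB Require Import structures.
From mathcomp Require Import all_boot all_order all_algebra.
From mathcomp Require Import reals.
From mathcomp Require Import complex.
Set Implicit Arguments. Unset Strict Implicit. Unset Printing Implicit Defensive.
Import Order.TTheory GRing.Theory Num.Theory.

(* ---------- Young diagrams ------------------------------------------- *)
(* A Young diagram is the (weakly decreasing) sequence of its positive row
   lengths; the empty diagram is [::]. *)
Definition is_part (l : seq nat) : bool := sorted geq l && all (fun x => 0 < x) l.

Definition ydiag := {l : seq nat | is_part l}.

Definition rows (la : ydiag) : seq nat := sval la.

Lemma is_part_nil : is_part [::]. Proof. by []. Qed.
Definition yempty : ydiag := exist _ [::] is_part_nil.

(* |la| = number of boxes *)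
Definition ysize (la : ydiag) : nat := sumn (rows la).

(* row length la_i, rows indexed from 1 *)
Definition yrow (la : ydiag) (i : nat) : nat := nth 0 (rows la) i.-1.
(* column length la'_j, columns indexed from 1 *)
Definition ycol (la : ydiag) (j : nat) : nat := count (fun x => j <= x) (rows la).

(* enumeration of all partitions of n with parts <= m (fuel = recursion depth) *)
Fixpoint parts_le (fuel n m : nat) : seq (seq nat) :=
  match fuel with
  | 0 => if n == 0 then [:: [::]] else [::]
  | f.+1 => if n == 0 then [:: [::]] else
      flatten [seq [seq k :: l | l <- parts_le f (n - k) k] | k <- iota 1 (minn n m)]
  end.

(* Y_n, the list of all Young diagrams with n boxes *)
Definition Yn (n : nat) : seq ydiag := pmap insub (parts_le n n n).

(* mu \subset la *)
Definition ysubset (mu la : ydiag) : bool :=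
  all (fun i => yrow mu i <= yrow la i) (iota 1 (size (rows mu))).

(* mu ↗ la *)
Definition yarrow (mu la : ydiag) : bool :=
  ysubset mu la && (ysize la == (ysize mu).+1).

(* number of chains mu = k_0 ↗ k_1 ↗ ... ↗ k_s = la of length s *)
Fixpoint nchains (s : nat) (mu la : ydiag) : nat :=
  match s with
  | 0 => (mu == la : nat)
  | s'.+1 => \sum_(ka <- Yn (ysize la).-1 | yarrow ka la) nchains s' mu ka
  end.

(* dim(mu, la) : number of chains mu ↗ ... ↗ la *)
Definition dimr (mu la : ydiag) : nat :=
  if ysize mu <= ysize la then nchains (ysize la - ysize mu) mu la else 0.

(* dim la *)
Definition ydim (la : ydiag) : nat := dimr yempty la.

(* ---------- real-valued notions ---------------------------------------- *)
Local Open Scope ring_scope.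

(* (z)_{nu/la} = prod over boxes (i,j) of nu/la of (z + j - i) *)
Definition poch (R : numDomainType) (z : R) (nu la : ydiag) : R :=
  \prod_(i <- iota 1 (size (rows nu)))
   \prod_(j <- iota (yrow la i).+1 (yrow nu i - yrow la i))
     (z + j%:R - i%:R).

(* number of diagonal boxes *)
Definition ydiagl (la : ydiag) : nat :=
  count (fun i => (i <= yrow la i)%N) (iota 1 (size (rows la))).

(* modified Frobenius coordinates a_i, b_i *)
Definition frob_a (R : realType) (la : ydiag) (i : nat) : R :=
  (yrow la i)%:R - i%:R + 2^-1.
Definition frob_b (R : realType) (la : ydiag) (i : nat) : R :=
  (ycol la i)%:R - i%:R + 2^-1.

(* the power sum p_k as a function on Young diagrams *)
Definition pk (R : realType) (k : nat) (la : ydiag) : R :=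
  \sum_(i <- iota 1 (ydiagl la))
    (frob_a R la i ^+ k + (-1) ^+ k.-1 * frob_b R la i ^+ k).

(* Lambda = R[p_1, p_2, ...], realised (injectively) as the algebra of
   functions on Y generated by the constants and the p_k, k >= 1. *)
Inductive inLam (R : realType) : (ydiag -> R) -> Prop :=
| Lam_const (c : R) : inLam (fun _ => c)
| Lam_p (k : nat) : (0 < k)%N -> inLam (pk R k)
| Lam_add (f g : ydiag -> R) : inLam f -> inLam g -> inLam (fun x => f x + g x)
| Lam_mul (f g : ydiag -> R) : inLam f -> inLam g -> inLam (fun x => f x * g x).

(* Frobenius-Schur function FS_mu as a function on Y *)
Definition FS (R : realType) (mu : ydiag) (la : ydiag) : R :=
  ((ysize la) ^_ (ysize mu))%:R * (dimr mu la)%:R / (ydim la)%:R.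

(* down transition p^down(nu, la) *)
Definition pdown (R : realType) (nu la : ydiag) : R :=
  if yarrow la nu then (ydim la)%:R / (ydim nu)%:R else 0.

(* (D_{n+1,n} f)(nu), for nu in Y_{n+1} *)
Definition Dop (R : realType) (n : nat) (f : ydiag -> R) (nu : ydiag) : R :=
  \sum_(la <- Yn n) pdown R nu la * f la.

(* parameters (z, z') : principal or complementary series *)
Definition zz_admissible (R : realType) (z z' : R[i]) : Prop :=
  (complex.Im z != 0 /\ z' = (z ^*)%C)
  \/ (exists N : int, complex.Im z = 0 /\ complex.Im z' = 0 /\
        N%:~R < complex.Re z < (N + 1)%:~R /\ N%:~R < complex.Re z' < (N + 1)%:~R).

(* up transition p^up(la, nu), for la in Y_n; the quantities
   (z)_{nu/la}(z')_{nu/la} and z z' are real under zz_admissible, and we take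
   their real parts to view them in R. *)
Definition pup (R : realType) (z z' : R[i]) (la nu : ydiag) : R :=
  if yarrow la nu then
    complex.Re (poch z nu la * poch z' nu la) / (complex.Re (z * z') + (ysize la)%:R)
    * (ydim nu)%:R / ((ysize la).+1%:R * (ydim la)%:R)
  else 0.

(* (U_{n,n+1} g)(la), for la in Y_n *)
Definition Uop (R : realType) (z z' : R[i]) (n : nat) (g : ydiag -> R) (la : ydiag) : R :=
  \sum_(nu <- Yn n.+1) pup z z' la nu * g nu.

(* T is a linear operator Lambda -> Lambda *)
Definition lam_linear_op (R : realType) (T : (ydiag -> R) -> (ydiag -> R)) : Prop :=
  (forall f, inLam f -> inLam (T f)) /\
  (forall (a : R) f g, inLam f -> inLam g ->
     T (fun x => a * f x + g x) = (fun x => a * T f x + T g x)).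

(* property characterising tilde D *)
Definition is_Dtilde (R : realType) (T : (ydiag -> R) -> (ydiag -> R)) : Prop :=
  lam_linear_op T /\
  (forall (n : nat) (f : ydiag -> R), inLam f ->
     forall nu, ysize nu = n.+1 -> Dop n f nu = (n.+1%:R)^-1 * T f nu).

(* property characterising tilde U *)
Definition is_Utilde (R : realType) (z z' : R[i]) (T : (ydiag -> R) -> (ydiag -> R)) : Prop :=
  lam_linear_op T /\
  (forall (n : nat) (f : ydiag -> R), inLam f ->
     forall la, ysize la = n ->
       Uop z z' n f la = (complex.Re (z * z') + n%:R)^-1 * T f la).

(* Main.v *)
(** By the branching rule, [Nop = p_1 - Tdown] multiplies [FS mu] by [|mu|], so
    everything about [Tdown] reduces to showing that [FS mu] lies in Lambda and that
    the [FS mu] span it.  Removing a box of content [c] changes [p_k] by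
    [(c+1/2)^k - (c-1/2)^k]; hence [Nop] is triangular for the degree filtration, with
    eigenvalue [d] in degree [d], as soon as the moments [M_k] of [c] under the
    cotransition measure lie in Lambda with leading term [p_{k+1}].  That measure is
    given by the residues of [prod (v - x_i) / prod (v - y_j)], where [x_i], [y_j] are
    the (shifted) contents of the row ends, and Newton's identities express [M_k]
    through the power sums of the [x_i] and [y_j].  Triangularity then yields both facts:
    an element of Lambda that is a delta function at [mu] among the diagrams with at
    most [|mu|] boxes is brought to a multiple of [FS mu] by applying factors
    [Nop - d], and an element of degree [< d] vanishing on all diagrams with fewer than
    [d] boxes is zero.
    The formula for the up operator comes from the commutation of adding and removing
    boxes: [sum over addable - sum over removable] of [(z+c)(z'+c)] is
    [z z' + 2 |la|]. *)
Require Import Defs.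
From HB Require Import structures.
From mathcomp Require Import all_boot all_order all_algebra.
From mathcomp Require Import boolp reals.
From mathcomp Require Import complex.
From mathcomp Require Import zify ring lra.
Set Implicit Arguments. Unset Strict Implicit. Unset Printing Implicit Defensive.
Import Order.TTheory GRing.Theory Num.Theory.

(** * Young diagrams *)

(* Rows are indexed from 0 here, from 1 in [yrow]. *)
Definition rowl (la : ydiag) (i : nat) : nat := nth 0 (rows la) i.

Lemma yrowS la i : yrow la i.+1 = rowl la i.
Proof. by []. Qed.

Lemma rowl_default la i : size (rows la) <= i -> rowl la i = 0.
Proof. by move=> h; rewrite /rowl nth_default. Qed.

Lemma rowl_gt0 la i : (0 < rowl la i) = (i < size (rows la)).
Proof.
case: (ltnP i (size (rows la))) => h; last by rewrite rowl_default.
have /andP[_ /allP pos] := svalP la.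
by apply: pos; apply: mem_nth.
Qed.

Lemma rowl_anti la i j : i <= j -> rowl la j <= rowl la i.
Proof.
move=> ij; case: (ltnP j (size (rows la))) => hj; last by rewrite (rowl_default hj).
have /andP[so _] := svalP la.
have geq_trans : transitive geq by move=> a b c /=; lia.
have geq_refl : reflexive geq by move=> a /=.
by have := sorted_leq_nth geq_trans geq_refl 0 so i j (leq_ltn_trans ij hj) hj ij.
Qed.

Lemma rowl_inj la mu : rowl la =1 rowl mu -> la = mu.
Proof.
move=> e; apply: val_inj => /=; apply: (@eq_from_nth _ 0); last by move=> i _; apply: e.
have h i : (i < size (rows la)) = (i < size (rows mu)) by rewrite -!rowl_gt0 e.
rewrite -/(rows la) -/(rows mu).
have := h (size (rows la)); have := h (size (rows mu)); lia.
Qed.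

(* Meaningful only for nonincreasing [f] with [f N = 0]. *)
Definition ofrow (f : nat -> nat) (N : nat) : ydiag :=
  insubd yempty (mkseq f (find (fun i => f i == 0) (iota 0 N))).

Lemma rowl_ofrow f N : (forall i, f i.+1 <= f i) -> f N = 0 -> rowl (ofrow f N) =1 f.
Proof.
move=> dec fN.
have anti i j : i <= j -> f j <= f i.
  by elim: j => [|j IH]; [case: i | rewrite leq_eqVlt => /predU1P[->//|/IH]; have := dec j; lia].
rewrite /ofrow; set k := find _ _.
have kN : k <= N by have := find_size (fun i => f i == 0) (iota 0 N); rewrite size_iota.
have pos i : i < k -> 0 < f i.
  move=> ik; have := before_find 0 ik; rewrite nth_iota ?add0n; lia.
(* [find] returns [N] when [f] has no zero below [N]; then [f N = 0] takes over. *)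
have zero i : k <= i -> f i = 0.
  move=> ki; suff : f k = 0 by have := anti _ _ ki; lia.
  case: (ltnP k N) => [kN'|]; last by move=> h; rewrite (_ : k = N) //; lia.
  have hs : has (fun i => f i == 0) (iota 0 N) by rewrite has_find size_iota.
  by have := nth_find 0 hs; rewrite -/k nth_iota // add0n => /eqP.
have ok : is_part (mkseq f k).
  apply/andP; split.
    apply/(sortedP 0) => i; rewrite size_mkseq => hi.
    by rewrite !nth_mkseq /=; [apply: dec | lia | lia].
  by rewrite /mkseq all_map; apply/allP => i; rewrite mem_iota => hi; apply: pos; lia.
move=> i; rewrite /rowl /rows insubdK //.
case: (ltnP i k) => h; first by rewrite nth_mkseq.
by rewrite nth_default ?size_mkseq // zero.
Qed.

Lemma ysizeE N la : size (rows la) <= N -> ysize la = \sum_(i < N) rowl la i.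
Proof.
move=> hN; rewrite /ysize sumnE (big_nth 0) big_mkord (big_ord_widen _ (fun i => nth 0 (rows la) i) hN).
rewrite [RHS](bigID (fun i : 'I_N => i < size (rows la))) /= [X in _ + X]big1 ?addn0 //.
by move=> i hi; rewrite rowl_default // leqNgt.
Qed.

Lemma size_rows_le la : size (rows la) <= ysize la.
Proof.
rewrite (@ysizeE (size (rows la))) // -{1}(card_ord (size (rows la))) -sum1_card.
by apply: leq_sum => i _; rewrite rowl_gt0.
Qed.

Lemma size_rows_mono la mu : (forall i, rowl la i <= rowl mu i) -> size (rows la) <= size (rows mu).
Proof.
move=> h; case: leqP => // lt; have := h (size (rows mu)).
by rewrite (rowl_default (leqnn _)) leqn0 => /eqP e; move: lt; rewrite -rowl_gt0 e.
Qed.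

Lemma sub_eq la mu : (forall i, rowl la i <= rowl mu i) -> ysize la = ysize mu -> la = mu.
Proof.
move=> h; rewrite (ysizeE (size_rows_mono h)) (@ysizeE (size (rows mu)) mu) // => e.
apply: rowl_inj => i; case: (ltnP i (size (rows mu))) => hi; last first.
  by rewrite !rowl_default // (leq_trans (size_rows_mono h)).
have := leqif_sum (fun (i : 'I_(size (rows mu))) (_ : true) => leqif_eq (h i)).
by move=> [_]; rewrite e eqxx => /esym/forallP/(_ (Ordinal hi))/eqP.
Qed.

(** * Enumeration of the diagrams with a given number of boxes *)

Lemma head_part k l : is_part (k :: l) = [&& 0 < k, is_part l & head 0 l <= k].
Proof.
rewrite /is_part; case: l => [|x l] /=; first by rewrite !andbT.
by case: (x <= k); case: (path _ _ _); case: (0 < k); case: (0 < x); rewrite ?andbF ?andbT.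
Qed.

(** Every recursive call takes a part [k >= 1] off [n], so fuel at least [n] cannot run out before
    the remainder is zero. *)
Lemma mem_parts_le fuel n m l : n <= fuel ->
  (l \in parts_le fuel n m) = [&& is_part l, sumn l == n & head 0 l <= m].
Proof.
elim: fuel n m l => [|f IH] n m l hn.
  rewrite /= (_ : n = 0) /=; last by lia.
  case: l => [|x l] //=; rewrite head_part inE /=.
  by case: x => //= x; rewrite andbF.
rewrite /=; case: (n =P 0) => [->|n0].
  case: l => [|x l] //=; rewrite head_part inE /=.
  by case: x => //= x; rewrite andbF.
apply/flatten_mapP/and3P => [[k]|[]].
  rewrite mem_iota => hk /mapP[l' + ->]; rewrite IH; last by lia.
  move=> /and3P[h1 /eqP h2 h3]; rewrite head_part h1 h3 /=; split; lia.
case: l => [|k l] /=; first by move=> _ /eqP; lia.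
rewrite head_part => /and3P[k0 h1 h3] /eqP h2 km; exists k; first by rewrite mem_iota; lia.
apply/mapP; exists l => //; rewrite IH ?h1 ?h3 ?andbT /=; lia.
Qed.

Lemma uniq_parts_le fuel n m : uniq (parts_le fuel n m).
Proof.
elim: fuel n m => [|f IH] n m /=; case: (n == 0) => //.
apply: (@allpairs_uniq_dep _ _ _ (fun k l => k :: l) (iota 1 (minn n m)) (fun k => parts_le f (n - k) k)).
- exact: iota_uniq.
- by move=> k _; apply: IH.
- by move=> [a b] [c d] _ _ /= [-> ->].
Qed.

Lemma mem_Yn n la : (la \in Yn n) = (ysize la == n).
Proof.
rewrite /Yn mem_pmap_sub mem_parts_le // (svalP la) /=.
rewrite -/(rows la) -/(ysize la) andbC; case: eqP => [<-|]; rewrite ?andbT ?andbF //.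
rewrite -nth0 -/(rowl la 0) (ysizeE (leqnSn _)) big_ord_recl /=; lia.
Qed.

Lemma uniq_Yn n : uniq (Yn n).
Proof. by apply: pmap_sub_uniq; apply: uniq_parts_le. Qed.

Lemma yarrowE la nu :
  yarrow la nu <-> (forall i, rowl la i <= rowl nu i) /\ ysize nu = (ysize la).+1.
Proof.
rewrite /yarrow; split=> [/andP[/allP h /eqP ->]|[h ->]].
  split=> // i; case: (ltnP i (size (rows la))) => hi; last by rewrite rowl_default.
  by apply: (h i.+1); rewrite mem_iota; lia.
rewrite eqxx andbT; apply/allP => i; rewrite mem_iota; case: i => // i _.
exact: h.
Qed.

Lemma yarrow_size la nu : yarrow la nu -> ysize nu = (ysize la).+1.
Proof. by move=> /yarrowE[]. Qed.

Lemma yarrowP la nu :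
  yarrow la nu <-> exists i, forall k, rowl nu k = rowl la k + (k == i).
Proof.
split=> [/yarrowE[h e]|[i h]].
  pose n := size (rows nu).
  have sl : size (rows la) <= n by exact: size_rows_mono.
  have [i hi] : exists i, rowl la i < rowl nu i.
    case: (@hasP _ (fun i => rowl la i < rowl nu i) (iota 0 n)) => [[i _ hi]|hn]; first by exists i.
    have : nu = la; last by move=> ee; move: e; rewrite ee; lia.
    apply: rowl_inj => i; case: (ltnP i n) => hi; last by rewrite !rowl_default // (leq_trans sl).
    have := h i; rewrite leq_eqVlt => /predU1P[//|lt]; case: hn; exists i => //.
    by rewrite mem_iota.
  exists i.
  have hin : i < n by rewrite -rowl_gt0; lia.
  move: e; rewrite (ysizeE sl) (@ysizeE n nu) // (bigD1 (Ordinal hin)) //= [in RHS](bigD1 (Ordinal hin)) //=.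
  set A := \sum_(_ < _ | _) _; set B := \sum_(_ < _ | _) _ => e.
  (* Row [i] grows by at least one box and the total by exactly one, so [A = B] and the other rows
     are unchanged. *)
  have AB : B <= A by apply: leq_sum => k _.
  have := leqif_sum (fun (k : 'I_n) (_ : k != Ordinal hin) => leqif_eq (h k)).
  rewrite -/A -/B => -[_]; rewrite (_ : B == A = true); last by lia.
  move=> /esym/forallP eqk k; case: eqP => [->|ki]; first lia.
  case: (ltnP k n) => hk; last by rewrite !rowl_default // (leq_trans sl).
  have := eqk (Ordinal hk); rewrite (_ : Ordinal hk != Ordinal hin) /=; first by move=> /eqP <-; lia.
  by apply/eqP => -[].
apply/yarrowE; split; first by move=> k; rewrite h; lia.
pose n := maxn (maxn (size (rows nu)) (size (rows la))) i.+1.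
rewrite (@ysizeE n nu) ?(@ysizeE n la); [|rewrite /n; lia ..].
have hin : i < n by rewrite /n; lia.
rewrite (eq_bigr (fun k : 'I_n => rowl la k + (k == Ordinal hin))); last by move=> k _; rewrite h.
by rewrite big_split /= (bigD1 (Ordinal hin) (P := predT)) // -[X in _ + X]big_mkcond /= big_pred1_eq addn1.
Qed.

(** * Addable and removable corners, unions and intersections *)

Definition addable (la : ydiag) (i : nat) : bool := (i == 0) || (rowl la i < rowl la i.-1).
Definition removable (nu : ydiag) (i : nat) : bool := rowl nu i.+1 < rowl nu i.

Definition yadd (la : ydiag) (i : nat) : ydiag :=
  ofrow (fun k => rowl la k + (k == i)) (size (rows la) + i).+1.
Definition yrem (nu : ydiag) (i : nat) : ydiag :=
  ofrow (fun k => rowl nu k - (k == i)) (size (rows nu)).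

Definition yjoin (la mu : ydiag) : ydiag :=
  ofrow (fun k => maxn (rowl la k) (rowl mu k)) (size (rows la) + size (rows mu)).
Definition ymeet (la mu : ydiag) : ydiag :=
  ofrow (fun k => minn (rowl la k) (rowl mu k)) (size (rows la) + size (rows mu)).

Lemma rowl_yadd la i : addable la i -> rowl (yadd la i) =1 (fun k => rowl la k + (k == i)).
Proof.
move=> h; apply: rowl_ofrow => [k|].
  have := rowl_anti la (leqnSn k); move: h; rewrite /addable.
  case: (i =P 0) => [->|i0] /=; first by rewrite /=; lia.
  case: (k.+1 =P i) => [<-|] /=; lia.
by rewrite rowl_default; lia.
Qed.

Lemma rowl_yrem nu i : removable nu i -> rowl (yrem nu i) =1 (fun k => rowl nu k - (k == i)).
Proof.
move=> h; apply: rowl_ofrow => [k|]; last by rewrite rowl_default.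
have := rowl_anti nu (leqnSn k); move: h; rewrite /removable.
by case: (k =P i) => [->|] /=; lia.
Qed.

Lemma rowl_yjoin la mu : rowl (yjoin la mu) =1 (fun k => maxn (rowl la k) (rowl mu k)).
Proof.
apply: rowl_ofrow => [k|]; last by rewrite !rowl_default //; lia.
by have := rowl_anti la (leqnSn k); have := rowl_anti mu (leqnSn k); lia.
Qed.

Lemma rowl_ymeet la mu : rowl (ymeet la mu) =1 (fun k => minn (rowl la k) (rowl mu k)).
Proof.
apply: rowl_ofrow => [k|]; last by rewrite !rowl_default //; lia.
by have := rowl_anti la (leqnSn k); have := rowl_anti mu (leqnSn k); lia.
Qed.

Lemma yarrow_yadd la i : addable la i -> yarrow la (yadd la i).
Proof. by move=> h; apply/yarrowP; exists i; apply: rowl_yadd. Qed.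

Lemma removable_rowl_gt0 nu i : removable nu i -> 0 < rowl nu i.
Proof. by rewrite /removable; lia. Qed.

Lemma yarrow_yrem nu i : removable nu i -> yarrow (yrem nu i) nu.
Proof.
move=> h; apply/yarrowP; exists i => k; rewrite rowl_yrem //.
have := removable_rowl_gt0 h; case: (k =P i) => [->|] /=; lia.
Qed.

Lemma removable_lt_size nu i : removable nu i -> i < size (rows nu).
Proof. by move=> /removable_rowl_gt0; rewrite rowl_gt0. Qed.

Lemma addable_le_size la i : addable la i -> i <= size (rows la).
Proof.
rewrite /addable; case: i => //= i h; have : 0 < rowl la i by lia.
by rewrite rowl_gt0.
Qed.

Lemma yarrow_remP la nu : yarrow la nu -> exists2 i, removable nu i & la = yrem nu i.
Proof.
move=> /yarrowP[i h].
have rem : removable nu i.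
  rewrite /removable !h eqxx (_ : i.+1 == i = false) ?addn0; last by lia.
  by have := rowl_anti la (leqnSn i); lia.
exists i => //; apply: rowl_inj => k; rewrite rowl_yrem // h; lia.
Qed.

Lemma yarrow_addP la nu : yarrow la nu -> exists2 i, addable la i & nu = yadd la i.
Proof.
move=> /yarrowP[i h].
have add : addable la i.
  rewrite /addable; case: i h => //= i h.
  have := rowl_anti nu (leqnSn i); rewrite !h eqxx (_ : i == i.+1 = false) ?addn0; lia.
by exists i => //; apply: rowl_inj => k; rewrite rowl_yadd.
Qed.

Lemma yrem_inj nu i j : removable nu i -> removable nu j -> yrem nu i = yrem nu j -> i = j.
Proof.
move=> hi hj e; have := rowl_yrem hi i; rewrite e rowl_yrem // eqxx.
by have := removable_rowl_gt0 hi; case: eqP => // _; lia.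
Qed.

Lemma yadd_inj la i j : addable la i -> addable la j -> yadd la i = yadd la j -> i = j.
Proof.
move=> hi hj e; have := rowl_yadd hi i; rewrite e rowl_yadd // eqxx.
by case: eqP => // _; lia.
Qed.

(** Removable rows parametrize the diagrams just below [nu]. Any bound [N] on the number of rows is
    allowed, so that neighbouring diagrams can share an index range. *)
Lemma sum_down (V : nmodType) (F : ydiag -> V) N nu : size (rows nu) <= N ->
  (\sum_(la <- Yn (ysize nu).-1 | yarrow la nu) F la
   = \sum_(i < N | removable nu i) F (yrem nu i))%R.
Proof.
move=> hN; rewrite -big_filter -(big_mkord (removable nu) (fun i => F (yrem nu i))).
rewrite -[RHS]big_filter -[RHS](big_map (yrem nu) predT F).
apply: perm_big; apply: uniq_perm.
- by rewrite filter_uniq // uniq_Yn.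
- rewrite map_inj_in_uniq ?filter_uniq ?iota_uniq // => i j.
  by rewrite !mem_filter => /andP[hi _] /andP[hj _]; apply: yrem_inj.
move=> la; rewrite mem_filter mem_Yn; apply/andP/mapP => [|[i + ->]].
  move=> [/yarrow_remP[i hi ->] _].
  exists i => //; rewrite mem_filter hi mem_index_iota /=.
  exact: leq_trans (removable_lt_size hi) hN.
rewrite mem_filter => /andP[hi _]; have h := yarrow_yrem hi; split=> //.
by rewrite (yarrow_size h).
Qed.

(** One index more than in [sum_down]: the added box may open a new row. *)
Lemma sum_up (V : nmodType) (F : ydiag -> V) N la : size (rows la) <= N ->
  (\sum_(nu <- Yn (ysize la).+1 | yarrow la nu) F nu
   = \sum_(i < N.+1 | addable la i) F (yadd la i))%R.
Proof.
move=> hN; rewrite -big_filter -(big_mkord (addable la) (fun i => F (yadd la i))).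
rewrite -[RHS]big_filter -[RHS](big_map (yadd la) predT F).
apply: perm_big; apply: uniq_perm.
- by rewrite filter_uniq // uniq_Yn.
- rewrite map_inj_in_uniq ?filter_uniq ?iota_uniq // => i j.
  by rewrite !mem_filter => /andP[hi _] /andP[hj _]; apply: yadd_inj.
move=> nu; rewrite mem_filter mem_Yn; apply/andP/mapP => [|[i + ->]].
  move=> [/yarrow_addP[i hi ->] _].
  exists i => //; rewrite mem_filter hi mem_index_iota /=.
  by have := addable_le_size hi; lia.
rewrite mem_filter => /andP[hi _]; have h := yarrow_yadd hi; split=> //.
by rewrite (yarrow_size h).
Qed.

Lemma ysize_gt0_removable nu : 0 < ysize nu -> exists i, removable nu i.
Proof.
move=> h; case E : (size (rows nu)) => [|m].
  by move: h; rewrite (@ysizeE 0) ?E // big_ord0.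
by exists m; rewrite /removable (@rowl_default nu m.+1) ?E // rowl_gt0 E.
Qed.

(** * Branching rule for the dimensions *)

Lemma dimr_eq mu la : ysize la = ysize mu -> dimr mu la = (mu == la).
Proof. by rewrite /dimr => ->; rewrite leqnn subnn. Qed.

Lemma dimr_rec mu la : ysize mu < ysize la ->
  dimr mu la = \sum_(ka <- Yn (ysize la).-1 | yarrow ka la) dimr mu ka.
Proof.
move=> h; rewrite {1}/dimr (ltnW h) (_ : _ - _ = (ysize la - (ysize mu).+1).+1); last by lia.
rewrite /=; apply: eq_bigr => ka /yarrow_size e; rewrite /dimr e.
by rewrite subSS (_ : ysize mu <= ysize ka) //; lia.
Qed.

Lemma ysize_eq0 la : ysize la = 0 -> la = yempty.
Proof.
move=> h; have := size_rows_le la; rewrite h leqn0 size_eq0 => /eqP e.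
exact: val_inj.
Qed.

Lemma ydim_gt0 la : 0 < ydim la.
Proof.
have [n] := ubnP (ysize la); elim: n la => // n IH la h.
case: (posnP (ysize la)) => h0; first by rewrite (ysize_eq0 h0) /ydim dimr_eq // eqxx.
rewrite /ydim dimr_rec // (sum_down _ (leqnn _)).
have [i hi] := ysize_gt0_removable h0.
rewrite (bigD1 (Ordinal (removable_lt_size hi))) //= addn_gt0 IH //.
by have := yarrow_size (yarrow_yrem hi); lia.
Qed.

Local Open Scope ring_scope.

(** * Contents of boxes; adding and removing boxes commute up to a diagonal term *)

Section Contents.
Variable R : realType.

(** The total content. For [yarrow la nu], the difference of the two totals is the content of the
    new box, expressed without reference to its row. *)
Definition csum (la : ydiag) : R :=
  \sum_(i < size (rows la)) \sum_(j < rowl la i) (j%:R - i%:R).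

Lemma csumE N la : (size (rows la) <= N)%N ->
  csum la = \sum_(i < N) \sum_(j < rowl la i) (j%:R - i%:R).
Proof.
move=> hN; rewrite /csum (big_ord_widen _ (fun i => \sum_(j < rowl la i) (j%:R - i%:R)) hN).
rewrite [RHS](bigID (fun i : 'I_N => i < size (rows la))%N) /= [X in _ + X]big1 ?addr0 //.
by move=> i hi; rewrite rowl_default ?big_ord0 // leqNgt.
Qed.

Lemma csum_addbox la nu i : (forall k, rowl nu k = rowl la k + (k == i))%N ->
  csum nu - csum la = (rowl la i)%:R - i%:R.
Proof.
move=> h; pose n := maxn (maxn (size (rows nu)) (size (rows la))) i.+1.
rewrite (@csumE n nu) ?(@csumE n la); [|rewrite /n; lia ..].
have hin : (i < n)%N by rewrite /n; lia.
rewrite (bigD1 (Ordinal hin)) //= [X in _ - X](bigD1 (Ordinal hin)) //=.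
rewrite h eqxx addn1 big_ord_recr /= [X in _ + X - _](eq_bigr (fun k : 'I_n => \sum_(j < rowl la k) (j%:R - k%:R : R))).
  by rewrite opprD addrACA subrr addr0 addrC addKr.
by move=> k; rewrite -val_eqE /= => /negbTE e; rewrite h e addn0.
Qed.

Lemma csum_yadd la i : addable la i -> csum (yadd la i) - csum la = (rowl la i)%:R - i%:R.
Proof. by move=> h; apply: csum_addbox; apply: rowl_yadd. Qed.

Lemma csum_yrem nu i : removable nu i -> csum nu - csum (yrem nu i) = (rowl nu i)%:R - i%:R - 1.
Proof.
move=> h; rewrite (@csum_addbox _ _ i); last first.
  by move=> k; rewrite rowl_yrem //; have := removable_rowl_gt0 h; case: (k =P i) => [->|] /=; lia.
rewrite rowl_yrem // eqxx natrB ?removable_rowl_gt0 //=; ring.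
Qed.

Lemma csum_join_meet la mu : csum (yjoin la mu) + csum (ymeet la mu) = csum la + csum mu.
Proof.
pose n := maxn (maxn (size (rows (yjoin la mu))) (size (rows (ymeet la mu))))
               (maxn (size (rows la)) (size (rows mu))).
rewrite !(@csumE n); [|rewrite /n; lia ..].
rewrite -!big_split /=; apply: eq_bigr => i _; rewrite rowl_yjoin rowl_ymeet.
by case: (leqP (rowl la i) (rowl mu i)) => _ //; rewrite addrC.
Qed.

Lemma ysize_join_meet la mu : (ysize (yjoin la mu) + ysize (ymeet la mu) = ysize la + ysize mu)%N.
Proof.
pose n := maxn (maxn (size (rows (yjoin la mu))) (size (rows (ymeet la mu))))
               (maxn (size (rows la)) (size (rows mu))).
rewrite !(@ysizeE n); [|rewrite /n; lia ..].
rewrite -!big_split /=; apply: eq_bigr => i _; rewrite rowl_yjoin rowl_ymeet; lia.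
Qed.

(** A common cover contains the union, which is strictly larger than [la] because [la] and [ka] are
    distinct of equal size; so it has the size of the union and equals it. *)
Lemma join_arrow la ka nu : la != ka -> ysize la = ysize ka ->
  yarrow la nu && yarrow ka nu = (nu == yjoin la ka) && (ysize (yjoin la ka) == (ysize la).+1).
Proof.
move=> ne e; apply/andP/andP => [[/yarrowE[h1 e1] /yarrowE[h2 e2]]|[/eqP -> /eqP s]]; last first.
  by split; apply/yarrowE; split; rewrite ?s -?e // => i; rewrite rowl_yjoin; lia.
have sub i : (rowl (yjoin la ka) i <= rowl nu i)%N by rewrite rowl_yjoin geq_max h1 h2.
have lt : (ysize la < ysize (yjoin la ka))%N.
  have le1 i : (rowl la i <= rowl (yjoin la ka) i)%N by rewrite rowl_yjoin; lia.
  have le2 i : (rowl ka i <= rowl (yjoin la ka) i)%N by rewrite rowl_yjoin; lia.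
  pose n := size (rows (yjoin la ka)).
  have le : (ysize la <= ysize (yjoin la ka))%N.
    rewrite (ysizeE (size_rows_mono le1)) (@ysizeE n) //; exact: leq_sum.
  move: le; rewrite leq_eqVlt => /predU1P[E|//].
  have E2 : ysize ka = ysize (yjoin la ka) by rewrite -e.
  by move: ne; rewrite (etrans (sub_eq le1 E) (esym (sub_eq le2 E2))) eqxx.
have le : (ysize (yjoin la ka) <= ysize nu)%N.
  rewrite (ysizeE (size_rows_mono sub)) (@ysizeE (size (rows nu)) nu) //; exact: leq_sum.
have E : ysize (yjoin la ka) = ysize nu by lia.
by rewrite (sub_eq sub E) eqxx e1.
Qed.

Lemma meet_arrow la ka rho : la != ka -> ysize la = ysize ka ->
  yarrow rho la && yarrow rho ka = (rho == ymeet la ka) && ((ysize (ymeet la ka)).+1 == ysize la).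
Proof.
move=> ne e; apply/andP/andP => [[/yarrowE[h1 e1] /yarrowE[h2 e2]]|[/eqP -> /eqP s]]; last first.
  by split; apply/yarrowE; split; rewrite ?s -?e // => i; rewrite rowl_ymeet; lia.
have sub i : (rowl rho i <= rowl (ymeet la ka) i)%N by rewrite rowl_ymeet leq_min h1 h2.
have lt : (ysize (ymeet la ka) < ysize la)%N.
  have le1 i : (rowl (ymeet la ka) i <= rowl la i)%N by rewrite rowl_ymeet; lia.
  have le2 i : (rowl (ymeet la ka) i <= rowl ka i)%N by rewrite rowl_ymeet; lia.
  have le : (ysize (ymeet la ka) <= ysize la)%N.
    rewrite (ysizeE (size_rows_mono le1)) (@ysizeE (size (rows la)) la) //; exact: leq_sum.
  move: le; rewrite leq_eqVlt => /predU1P[E|//].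
  have E2 : ysize (ymeet la ka) = ysize ka by rewrite -e.
  by move: ne; rewrite (etrans (esym (sub_eq le1 E)) (sub_eq le2 E2)) eqxx.
have le : (ysize rho <= ysize (ymeet la ka))%N.
  rewrite (ysizeE (size_rows_mono sub)) (@ysizeE (size (rows (ymeet la ka))) (ymeet la ka)) //; exact: leq_sum.
have E : ysize rho = ysize (ymeet la ka) by lia.
by rewrite (sub_eq sub E) eqxx -E e1.
Qed.

Lemma big_Yn_eq1 (V : nmodType) n (P : pred ydiag) a (b : bool) (F : ydiag -> V) :
  (forall x, P x = (x == a) && b) -> (b -> ysize a = n) ->
  \sum_(x <- Yn n | P x) F x = if b then F a else 0.
Proof.
move=> h ha; rewrite -big_filter; case: b h ha => h ha.
  rewrite (eq_filter (a2 := pred1 a)); last by move=> x; rewrite h andbT.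
  by rewrite filter_pred1_uniq ?uniq_Yn ?big_seq1 // mem_Yn ha.
by rewrite (eq_filter (a2 := pred0)) ?filter_pred0 ?big_nil // => x; rewrite h andbF.
Qed.

(** The sizes of union and intersection add up to [2 |la|], so the union covers both diagrams
    exactly when both cover the intersection, and each sum has at most one term. Total contents
    balance in the same way, so the two boxes have equal content. *)
Lemma diamond (F : R -> R) la ka : la != ka -> ysize la = ysize ka ->
  \sum_(nu <- Yn (ysize la).+1 | yarrow la nu && yarrow ka nu) F (csum nu - csum la)
  = \sum_(rho <- Yn (ysize la).-1 | yarrow rho la && yarrow rho ka) F (csum ka - csum rho).
Proof.
move=> ne e.
rewrite (big_Yn_eq1 _ (fun nu => join_arrow nu ne e)); last by move/eqP.
rewrite (big_Yn_eq1 _ (fun nu => meet_arrow nu ne e)); last by move/eqP <-.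
have := ysize_join_meet la ka; rewrite e => s.
rewrite (_ : (_ == _) = ((ysize (ymeet la ka)).+1 == ysize ka)); last by lia.
case: ifP => // _; congr F; have := csum_join_meet la ka => c; lra.
Qed.

(* Telescoping: row [i.+1] is not addable exactly when row [i] is not removable,
   and then the two would-be boxes have the same content. *)
Lemma corner_sum (F : R -> R) N la : (size (rows la) <= N)%N ->
  \sum_(nu <- Yn (ysize la).+1 | yarrow la nu) F (csum nu - csum la)
  - \sum_(rho <- Yn (ysize la).-1 | yarrow rho la) F (csum la - csum rho)
  = \sum_(i < N.+1) F ((rowl la i)%:R - i%:R) - \sum_(i < N) F ((rowl la i)%:R - i%:R - 1).
Proof.
move=> hN; rewrite (sum_up _ hN) (sum_down _ hN).
rewrite (eq_bigr (fun i : 'I_N.+1 => F ((rowl la i)%:R - i%:R))); last first.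
  by move=> i h; rewrite csum_yadd.
rewrite [X in _ - X](eq_bigr (fun i : 'I_N => F ((rowl la i)%:R - i%:R - 1))); last first.
  by move=> i h; rewrite csum_yrem.
rewrite [X in _ = X - _](bigID (fun i : 'I_N.+1 => addable la i)) /=.
rewrite [X in _ = _ - X](bigID (fun i : 'I_N => removable la i)) /=.
set A := \sum_(_ < _ | _) _; set B := \sum_(_ < _ | _) _.
set C := \sum_(_ < _ | _) _; set D := \sum_(_ < _ | _) _.
suff -> : C = D by ring.
rewrite /C big_mkcond big_ord_recl /= add0r -big_mkcond /D; apply: eq_big => i.
  by rewrite /addable /removable /bump leq0n add1n.
rewrite /addable /bump leq0n add1n /= => h; congr F.
have -> : rowl la i.+1 = rowl la i by have := rowl_anti la (leqnSn i); lia.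
by rewrite -natr1; ring.
Qed.

(* The off-diagonal terms of the two double sums agree by the diamond property. *)
Lemma up_down_commute (F : R -> R) (g : ydiag -> R) la :
  \sum_(nu <- Yn (ysize la).+1 | yarrow la nu)
     \sum_(ka <- Yn (ysize la) | yarrow ka nu) F (csum nu - csum la) * g ka
  = \sum_(rho <- Yn (ysize la).-1 | yarrow rho la)
     \sum_(ka <- Yn (ysize la) | yarrow rho ka) F (csum ka - csum rho) * g ka
  + (\sum_(nu <- Yn (ysize la).+1 | yarrow la nu) F (csum nu - csum la)
     - \sum_(rho <- Yn (ysize la).-1 | yarrow rho la) F (csum la - csum rho)) * g la.
Proof.
rewrite (exchange_big_dep predT) //= [X in _ = X + _](exchange_big_dep predT) //=.
have hla : la \in Yn (ysize la) by rewrite mem_Yn.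
rewrite (bigD1_seq la) ?uniq_Yn //= [X in _ = X + _](bigD1_seq la) ?uniq_Yn //=.
under eq_bigl do rewrite andbb.
under [X in _ = X + _ + _]eq_bigl do rewrite andbb.
rewrite -!big_distrl /= mulrBl addrAC [X in _ = X + _]addrC subrK; congr (_ + _).
rewrite big_seq_cond [RHS]big_seq_cond; apply: eq_bigr => ka /andP[].
rewrite mem_Yn => /eqP e ne; rewrite -!big_distrl /=; congr (_ * _).
by apply: diamond; rewrite // eq_sym.
Qed.

End Contents.

(** * Power sums in terms of contents *)

(** A downward closed property selects an initial segment, whose length is the count. This reads
    column lengths and the number of diagonal boxes off the rows. *)
Lemma lt_count_iota (P : pred nat) n i :
  (forall i j, (i <= j)%N -> P j -> P i) -> (forall i, P i -> (i < n)%N) ->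
  (i < count P (iota 0 n))%N = P i.
Proof.
move=> down bnd.
have -> : P i = (i \in filter P (iota 0 n)).
  by rewrite mem_filter mem_iota /=; case E : (P i) => //=; rewrite (bnd _ E).
rewrite -size_filter; suff -> : filter P (iota 0 n) = iota 0 (size (filter P (iota 0 n))).
  by rewrite mem_iota size_iota.
elim: n {bnd} => // n IH; rewrite -addn1 iotaD add0n filter_cat /=.
case E : (P n); last by rewrite cats0.
have -> : filter P (iota 0 n) = iota 0 n.
  by apply/all_filterP/allP => j; rewrite mem_iota => hj; apply: down E; lia.
by rewrite size_cat !size_iota iotaD.
Qed.

Lemma rows_map la : rows la = map (rowl la) (iota 0 (size (rows la))).
Proof. by rewrite -/(mkseq _ _) mkseq_nth. Qed.

Lemma lt_ycol la i j : (i < ycol la j.+1)%N = (j < rowl la i)%N.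
Proof.
rewrite /ycol {1}rows_map count_map; apply: lt_count_iota => [a b ab /=|a /=].
  by have := rowl_anti la ab; lia.
by rewrite -rowl_gt0; lia.
Qed.

Lemma lt_ydiagl la i : (i < ydiagl la)%N = (i < rowl la i)%N.
Proof.
rewrite /ydiagl (iotaDl 1 0) count_map.
apply: (lt_count_iota (P := fun a => a < rowl la a)%N) => [a b ab /=|a /=].
  by have := rowl_anti la ab; lia.
by rewrite -rowl_gt0; lia.
Qed.

Section PowerSums.
Variable R : realType.

Definition onehalf : R := 2^-1.
(** What a box of content [c] contributes to [p_k], by [pk_boxes]. *)
Definition boxdiff (k : nat) (c : R) : R := (c + onehalf) ^+ k - (c - onehalf) ^+ k.
(** The content of the last box of row [i]; an empty row gets [-i - 1], which keeps the sequence
    strictly decreasing. *)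
Definition content (la : ydiag) (i : nat) : R := (rowl la i)%:R - i%:R - 1.

Lemma sum_ord_interval N i r (G : nat -> R) : (r <= N)%N ->
  \sum_(j < N | (i <= j)%N && (j < r)%N) G j = \sum_(i <= j < r) G j.
Proof.
move=> h; rewrite (big_nat_widenl i 0) // (big_nat_widen 0 r N) // big_mkord.
by apply: eq_bigl => j /=; rewrite andbC.
Qed.

(** The diagram is cut into hooks at the diagonal boxes. An arm, diagonal box included, telescopes
    to [a^k - (-1/2)^k], and the leg to [(-1/2)^k - (-b)^k]. *)
Lemma pk_boxes k la N : (0 < k)%N -> (size (rows la) <= N)%N -> (rowl la 0 <= N)%N ->
  pk R k la = \sum_(i < N) \sum_(j < N | (j < rowl la i)%N) boxdiff k (j%:R - i%:R).
Proof.
move=> k0 hN hN0.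
have dN : (ydiagl la <= N)%N.
  by rewrite leqNgt lt_ydiagl rowl_default.
have -> : pk R k la = \sum_(i < N | (i < rowl la i)%N)
    (frob_a R la i.+1 ^+ k + (-1) ^+ k.-1 * frob_b R la i.+1 ^+ k).
  rewrite /pk (iotaDl 1 0) big_map.
  rewrite (_ : iota 0 (ydiagl la) = index_iota 0 (ydiagl la)); last by rewrite /index_iota subn0.
  rewrite (big_nat_widen 0 _ N) // big_mkord; apply: eq_bigl => i /=; exact: lt_ydiagl.
rewrite [RHS](eq_bigr (fun i : 'I_N =>
   \sum_(j < N | (j < rowl la i)%N && (i <= j)%N) boxdiff k (j%:R - i%:R)
   + \sum_(j < N | (j < rowl la i)%N && ~~ (i <= j)%N) boxdiff k (j%:R - i%:R))); last first.
  by move=> i _; rewrite (bigID (fun j : 'I_N => i <= j)%N).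
(* Boxes below the diagonal are regrouped by columns, so that index [i] collects one hook. *)
rewrite [RHS]big_split /= [X in _ = _ + X](exchange_big_dep predT) //= -[RHS]big_split /=.
rewrite big_mkcond /=; apply: eq_bigr => i _.
have rN : (rowl la i <= N)%N by apply: leq_trans (rowl_anti la (leq0n i)) hN0.
have cN : (ycol la i.+1 <= N)%N by rewrite leqNgt lt_ycol rowl_default.
rewrite (eq_bigl (fun j : 'I_N => (i <= j)%N && (j < rowl la i)%N)); last first.
  by move=> j; rewrite andbC.
rewrite (sum_ord_interval _ (fun j => boxdiff k (j%:R - i%:R))) //.
rewrite [X in _ = _ + X](eq_bigl (fun j : 'I_N => (i.+1 <= j)%N && (j < ycol la i.+1)%N)); last first.
  by move=> j; rewrite -ltnNge lt_ycol andbC.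
rewrite (sum_ord_interval _ (fun j => boxdiff k (i%:R - j%:R))) //.
case: ifP => [hi|/negbT]; last first.
  rewrite -leqNgt => hi; rewrite !big_geq ?addr0 //.
  by rewrite leqNgt lt_ycol -leqNgt; apply: leq_trans hi; apply: rowl_anti.
have hc : (i < ycol la i.+1)%N by rewrite lt_ycol.
rewrite (eq_bigr (fun j => (j.+1%:R - i%:R - onehalf) ^+ k - (j%:R - i%:R - onehalf) ^+ k)); last first.
  by move=> j _; rewrite /boxdiff; congr (_ ^+ _ - _); rewrite -natr1 /onehalf; field.
rewrite telescope_sumr; last exact: ltnW.
rewrite [X in _ = _ + X](eq_bigr (fun j => - (i%:R - j.+1%:R + onehalf) ^+ k - - (i%:R - j%:R + onehalf) ^+ k)); last first.
  by move=> j _; rewrite /boxdiff opprK addrC; congr (- _ ^+ _ + _); rewrite -natr1 /onehalf; field.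
rewrite telescope_sumr; last exact: hc.
rewrite /frob_a /frob_b !yrowS -/onehalf.
have -> : (i%:R - i.+1%:R + onehalf : R) = i%:R - i%:R - onehalf by rewrite -natr1 /onehalf; field.
have -> : (i%:R - (ycol la i.+1)%:R + onehalf : R) = - ((ycol la i.+1)%:R - i.+1%:R + onehalf).
  by rewrite -natr1 /onehalf; field.
have -> : ((rowl la i)%:R - i.+1%:R + onehalf : R) = (rowl la i)%:R - i%:R - onehalf.
  by rewrite -natr1 /onehalf; field.
set y := _ - i.+1%:R + onehalf.
have -> : (- y) ^+ k = - (-1) ^+ k.-1 * y ^+ k.
  by rewrite exprNn -{1}(prednK k0) exprS mulN1r.
by move: (_ ^+ k.-1) => s; ring.
Qed.

Lemma row_telescope k la i :
  \sum_(j < rowl la i) boxdiff k (j%:R - i%:R)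
  = (content la i + onehalf) ^+ k - (- i%:R - onehalf) ^+ k.
Proof.
rewrite -(big_mkord predT (fun j => boxdiff k (j%:R - i%:R))).
rewrite (eq_bigr (fun j => (j.+1%:R - i%:R - onehalf) ^+ k - (j%:R - i%:R - onehalf) ^+ k)); last first.
  by move=> j _; rewrite /boxdiff; congr (_ ^+ _ - _); rewrite -natr1 /onehalf; field.
by rewrite telescope_sumr // /content; congr (_ ^+ _ - _ ^+ _); rewrite /onehalf; field.
Qed.

Lemma pk_rows k la N : (0 < k)%N -> (size (rows la) <= N)%N ->
  pk R k la = \sum_(i < N) ((content la i + onehalf) ^+ k - (- i%:R - onehalf) ^+ k).
Proof.
(* [pk_boxes] also needs a bound on the columns, hence [N + rowl la 0]; the extra rows are empty and
   contribute zero. *)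
move=> k0 hN; rewrite (@pk_boxes k la (N + rowl la 0)) //; [|lia|lia].
rewrite (eq_bigr (fun i : 'I_(N + rowl la 0) => (content la i + onehalf) ^+ k - (- i%:R - onehalf) ^+ k)); last first.
  move=> i _; rewrite -row_telescope.
  rewrite -(big_ord_widen _ (fun j => boxdiff k (j%:R - i%:R))) //.
  by have := rowl_anti la (leq0n i); lia.
rewrite big_split_ord /= [X in _ + X]big1 ?addr0 // => i _.
rewrite /content rowl_default; last by lia.
by rewrite (_ : 0%:R - (N + i)%:R - 1 + onehalf = - (N + i)%:R - onehalf) ?subrr // /onehalf; field.
Qed.

Lemma pk1 la : pk R 1 la = (ysize la)%:R.
Proof.
rewrite (@pk_rows 1 la (size (rows la))) // (@ysizeE (size (rows la)) la) // natr_sum.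
by apply: eq_bigr => i _; rewrite !expr1 /content /onehalf; field.
Qed.

End PowerSums.

(** * Residues and Newton identities *)

Section Residues.
Variable F : numFieldType.

(** Only positive integers are tested: [lagrange_rev] evaluates at an inverse, and one-row diagrams
    are compared only when nonempty. *)
Lemma poly_eq0_nat (p : {poly F}) : (forall n : nat, p.[n.+1%:R] = 0) -> p = 0.
Proof.
move=> h; apply/eqP; apply/negPn/negP => p0.
have := @max_poly_roots _ p (mkseq (fun n => n.+1%:R : F) (size p)) p0.
rewrite size_mkseq ltnn => H; suff: false by []; apply: H.
  by apply/allP => x /mapP[n _ ->]; rewrite /root h.
by rewrite map_inj_uniq ?iota_uniq // => a b /eqP; rewrite eqr_nat => /eqP[].
Qed.

Lemma geom_mul (y : F) K :
  (1 - y%:P * 'X) * (\sum_(k < K) (y ^+ k)%:P * 'X^k) = 1 - (y ^+ K)%:P * 'X^K.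
Proof.
elim: K => [|K IH]; first by rewrite big_ord0 mulr0 !expr0 mulr1 subrr.
rewrite big_ord_recr /= mulrDr IH !exprS polyCM; ring.
Qed.

(** The reversed polynomial of [prod (X - x_i)], with constant term 1. *)
Definition invgen (I : finType) (P : pred I) (x : I -> F) : {poly F} :=
  \prod_(i | P i) (1 - (x i)%:P * 'X).

(** The generating series of the power sums [p_(k+1)], truncated modulo [X^K]. *)
Definition powgen (I : finType) (x : I -> F) (K : nat) : {poly F} :=
  \sum_i \sum_(k < K) (x i ^+ k.+1)%:P * 'X^k.

Lemma dvdXn_deriv (p : {poly F}) K : 'X^(K.+1) %| p -> 'X^K %| p^`().
Proof.
move=> /dvdpP[q ->]; rewrite derivM derivXn dvdp_add //.
  by apply: dvdp_mull; rewrite exprS dvdp_mull.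
by rewrite /= -mulr_natr; apply: dvdp_mull; apply: dvdp_mulr.
Qed.

(** A factor [1 - x_i X] has logarithmic derivative [- x_i / (1 - x_i X)], a geometric series.
    Denominators are cleared, and divisibility by [X^K] stands for an identity of truncated
    series. *)
Lemma log_deriv (I : finType) (x : I -> F) K :
  'X^K %| (invgen xpredT x)^`() + invgen xpredT x * powgen x K.
Proof.
rewrite /invgen /powgen; elim: (index_enum I) => [|i s IH].
  by rewrite !big_nil derivC mulr0 addr0 dvdp0.
rewrite !big_cons derivM; set A := \prod_(j <- s) _ in IH *; set B := \sum_(j <- s) _ in IH *.
have -> : \sum_(k < K) (x i ^+ k.+1)%:P * 'X^k = (x i)%:P * \sum_(k < K) (x i ^+ k)%:P * 'X^k.
  by rewrite big_distrr; apply: eq_bigr => k _; rewrite exprS polyCM /= mulrA.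
set G := \sum_(k < K) _.
have -> : (1 - (x i)%:P * 'X)^`() * A + (1 - (x i)%:P * 'X) * A^`()
    + (1 - (x i)%:P * 'X) * A * ((x i)%:P * G + B)
  = (1 - (x i)%:P * 'X) * (A^`() + A * B) - (x i)%:P * A * (1 - (1 - (x i)%:P * 'X) * G).
  by rewrite derivB derivM !derivC derivX; ring.
rewrite geom_mul dvdp_sub //; first exact: dvdp_mull.
by rewrite opprB addrC subrK; apply: dvdp_mull; apply: dvdp_mull.
Qed.

Lemma coprimeXn_invgen (I : finType) (x : I -> F) K : coprimep 'X^K (invgen xpredT x).
Proof.
apply: coprimep_expl; rewrite coprimep_sym -['X]subr0 coprimep_XsubC /root /invgen horner_prod.
rewrite big1 ?oner_eq0 // => i _.
by rewrite !hornerE subr0.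
Qed.

Variables (N : nat) (x : 'I_N.+1 -> F) (y : 'I_N -> F).
Hypothesis y_inj : injective y.
Hypothesis sum_xy : \sum_k x k = \sum_i y i.

(** Minus the residue of [prod (v - x_k) / prod (v - y_j)] at [v = y_i]; with this sign the values
    attached to a diagram add up to its size. *)
Definition res (i : 'I_N) : F :=
  - (\prod_k (y i - x k)) / \prod_(j | j != i) (y i - y j).
Definition resmom (k : nat) : F := \sum_i res i * y i ^+ k.
Definition hdiff (j : nat) : F := \sum_k x k ^+ j - \sum_i y i ^+ j.

Lemma coefPn_prod_ord (n : nat) (f : 'I_n -> F) : (0 < n)%N ->
  (\prod_i ('X - (f i)%:P))`_n.-1 = - \sum_i f i.
Proof.
have sz : size (index_enum 'I_n) = n.
  have := size_prod_XsubC (enum 'I_n) f; rewrite big_enum /= size_prod_XsubC size_enum_ord.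
  by case.
move=> n0; have := @coefPn_prod_XsubC _ (map f (index_enum 'I_n)).
by rewrite size_map sz -lt0n !big_map; apply.
Qed.

(** Partial fractions with denominators cleared. The difference [D] has degree less than [N]: terms
    in [X^(N+1)] cancel as both products are monic, terms in [X^N] by [sum_xy]. It vanishes at the
    [N] distinct points [y_i]. *)
Lemma lagrange_poly :
  \prod_k ('X - (x k)%:P) = 'X * \prod_i ('X - (y i)%:P)
    - \sum_i (res i)%:P * \prod_(j | j != i) ('X - (y j)%:P).
Proof.
apply/eqP; rewrite -subr_eq0 opprB addrCA; set D := _ + _.
have sizeQ i : (size (\prod_(j | j != i) ('X - (y j)%:P) : {poly F})%R <= N)%N.
  have := size_prod_XsubC (enum (fun j => j != i)) y; rewrite big_enum => ->.
  by rewrite -cardE; have := cardC1 i; rewrite card_ord => ->; have := ltn_ord i; lia.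
have mon (n : nat) (f : 'I_n -> F) : \prod_i ('X - (f i)%:P) \is monic by exact: monic_prod_XsubC.
have size_n (n : nat) (f : 'I_n -> F) : size (\prod_i ('X - (f i)%:P)) = n.+1.
  by have := size_prod_XsubC (enum 'I_n) f; rewrite big_enum size_enum_ord.
have sizeD : (size D <= N)%N.
  rewrite /D (leq_trans (size_polyD _ _)) // geq_max; apply/andP; split.
    apply: (leq_trans (size_sum _ _ _)); apply/bigmax_leqP => i _.
    by rewrite mul_polyC (leq_trans (size_scale_leq _ _)).
  (* The coefficients of order [N], [N + 1] and beyond, in turn; [N = 0] is apart since [N.-1] is
     then no genuine predecessor. *)
  apply/leq_sizeP => j; rewrite leq_eqVlt => /predU1P[<-|].
    rewrite coefB coefXM -[X in _`_X]/(N.+1.-1) coefPn_prod_ord // sum_xy.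
    case: eqP => [N0|/eqP N0]; last by rewrite coefPn_prod_ord ?lt0n // subrr.
    by rewrite subr0 big1 ?oppr0 // => i; have := ltn_ord i; rewrite {2}N0.
  rewrite leq_eqVlt => /predU1P[<-|hj].
    rewrite coefB coefXM /= -[X in _ - X]/(_`_(N.+1.-1)).
    have lc n (f : 'I_n -> F) : (\prod_i ('X - (f i)%:P))`_n = 1.
      by have /monicP := mon n f; rewrite /lead_coef size_n.
    by rewrite !lc subrr.
  rewrite coefB coefXM (_ : j == 0 = false)%N; last by lia.
  by rewrite !nth_default ?size_n ?subrr //; lia.
apply/negPn/negP => D0.
have := @max_poly_roots _ D (map y (enum 'I_N)) D0.
rewrite size_map size_enum_ord ltnNge sizeD => H; suff: false by []; apply: H; last first.
  by rewrite map_inj_uniq ?enum_uniq.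
apply/allP => _ /mapP[i _ ->]; rewrite /root /D !hornerE horner_sum !horner_prod /=.
rewrite [X in _ - _ * X](bigD1 i) //= hornerXsubC subrr mul0r mulr0 subr0.
rewrite (bigD1 i) //= [X in _ + X + _]big1 => [|j ji]; last first.
  rewrite hornerM horner_prod (bigD1 i) /=; last by rewrite eq_sym.
  by rewrite hornerXsubC subrr mul0r mulr0.
rewrite addr0 hornerM hornerC horner_prod /res.
under [X in _ / _ * X]eq_bigr do rewrite hornerXsubC.
under [X in _ + X]eq_bigr do rewrite hornerXsubC.
rewrite divfK ?addNr //; apply/prodf_neq0 => j ji.
by rewrite subr_eq0; apply: contra ji => /eqP/y_inj ->.
Qed.

(** This is [lagrange_poly] at [1/t], multiplied by [t^(N+1)]. *)
Lemma lagrange_rev :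
  invgen xpredT x = invgen xpredT y
    - \sum_i (res i)%:P * 'X^2 * invgen (fun j => j != i) y.
Proof.
apply/eqP; rewrite -subr_eq0; apply/eqP; apply: poly_eq0_nat => n.
move: (n.+1%:R) (pnatr_eq0 F n.+1) => t /= /negbT t0.
have rev (I : finType) (P : pred I) (f : I -> F) :
    (invgen P f).[t] = t ^+ #|P| * (\prod_(i | P i) ('X - (f i)%:P)).[t^-1].
  rewrite (_ : t ^+ #|P| = \prod_(i | P i) t); last by rewrite -prodr_const; apply: eq_bigl.
  rewrite /invgen !horner_prod -big_split /=; apply: eq_bigr => i _; rewrite !hornerE /=.
  by field.

rewrite !hornerE rev lagrange_poly rev !hornerE !horner_sum.
rewrite !card_ord.
have Q0 i : (#|fun j : 'I_N => j != i|).+1 = N.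
  by have := cardC1 i; rewrite card_ord => ->; have := ltn_ord i; lia.
under [X in _ - (_ - X)]eq_bigr => i _ do rewrite !hornerE rev.
under [X in _ * (_ - X) - _]eq_bigr => i _ do rewrite hornerM hornerC.
set A := (\prod_i _).[_].
have e1 : t ^+ N.+1 * (t^-1 * A) = t ^+ N * A by rewrite exprSr mulrA mulfK.
apply/eqP; rewrite mulrBr e1 /= subr_eq0 (inj_eq (addrI _)) eqr_opp big_distrr /=.
apply/eqP; apply: eq_bigr => i _; set m := #|_|.
have -> : t ^+ N.+1 = t * (t * t ^+ m) by rewrite -!exprS Q0.
by ring.
Qed.

(** Expanding [lagrange_rev] in geometric series gives [invgen x = invgen y * E] modulo [X^(K+1)].
    Logarithmic derivatives turn this into [E' + E * (powgen x - powgen y) = 0] modulo [X^K], whose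
    coefficient of [X^(k+1)] is the claim. *)
Lemma newton_res k :
  k.+2%:R * resmom k = hdiff k.+2 - \sum_(m < k) resmom m * hdiff (k - m).
Proof.
pose K := k.+2.
pose E : {poly F} := 1 - \sum_(m < K) (resmom m)%:P * 'X^(m.+2).
have XE : 'X^(K.+1) %| invgen xpredT y * E - invgen xpredT x.
  rewrite lagrange_rev /E mulrBr mulr1 opprB addrC addrA subrK.
  rewrite (_ : \sum_(m < K) _ = \sum_i (res i)%:P * 'X^2 * \sum_(m < K) (y i ^+ m)%:P * 'X^m); last first.
    under eq_bigr do rewrite /resmom rmorph_sum big_distrl /=.
    rewrite exchange_big; apply: eq_bigr => i _; rewrite big_distrr; apply: eq_bigr => m _ /=.
    by rewrite polyCM !exprS; ring.
  rewrite big_distrr -sumrB /=; apply: (big_ind (fun p : {poly F} => 'X^(K.+1) %| p)) => [|p q|i _]; [exact: dvdp0 | exact: dvdp_add |].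
  rewrite {2}/invgen (bigD1 i) //= -/(invgen (fun j => j != i) y).
  set Z := invgen _ y; set G := \sum_(m < K) _.
  rewrite (_ : _ - _ = (res i)%:P * 'X^2 * Z * (1 - (1 - (y i)%:P * 'X) * G)); last by ring.
  rewrite geom_mul opprB addrC subrK.
  rewrite (_ : _ * _ = (res i)%:P * Z * (y i ^+ K)%:P * 'X * 'X^(K.+1)) ?dvdp_mulIr //.
  by move: (_ ^+ K)%:P => c; rewrite [in RHS]exprS expr2; ring.
have := dvdXn_deriv XE; rewrite derivB derivM => XD.
have main : 'X^K %| E^`() + E * (powgen x K - powgen y K).
  (* [invgen y] is coprime to [X^K], so it can be cancelled. *)
  rewrite -(@Gauss_dvdpr _ _ (invgen xpredT y)) ?coprimeXn_invgen //.
  set iy := invgen _ y in XE XD *; set ix := invgen _ x in XE XD *.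
  have -> : iy * (E^`() + E * (powgen x K - powgen y K)) =
    (iy^`() * E + iy * E^`() - ix^`()) + (ix^`() + ix * powgen x K)
    + (iy * E - ix) * powgen x K - E * (iy^`() + iy * powgen y K) by ring.
  apply: dvdp_sub; last by apply: dvdp_mull; apply: log_deriv.
  apply: dvdp_add; first by apply: dvdp_add XD _; apply: log_deriv.
  by apply: dvdp_mulr; apply: dvdp_trans XE; rewrite exprS dvdp_mulIr.
have coefpow (I : finType) (f : I -> F) j : (j < K)%N -> (powgen f K)`_j = \sum_i f i ^+ j.+1.
  move=> hj; rewrite /powgen coef_sum; apply: eq_bigr => i _.
  rewrite coef_sum (bigD1 (Ordinal hj)) //= coefCM coefXn eqxx mulr1 big1 ?addr0 // => m hm.
  by rewrite coefCM coefXn eq_sym (negbTE (hm : (m : nat) != j)) mulr0.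
have E0 : E`_0 = 1.
  rewrite /E coefB coef1 coef_sum big1 ?subr0 // => m _.
  by rewrite coefCM coefXn mulr0.
(* As [E] has no linear term, the convolution passes from [hdiff k.+2] directly to the products
   [resmom m * hdiff (k - m)]. *)
have E1 : E`_1 = 0.
  rewrite /E coefB coef1 coef_sum big1 ?subr0 // => m _.
  by rewrite coefCM coefXn mulr0.
have E2 m : (m < K)%N -> E`_(m.+2) = - resmom m.
  move=> hm; rewrite /E coefB coef1 coef_sum (bigD1 (Ordinal hm)) //= coefCM coefXn eqxx mulr1.
  rewrite big1 ?addr0 ?sub0r // => j hj.
  by rewrite coefCM coefXn !eqSS eq_sym (negbTE (hj : (j : nat) != m)) mulr0.
have : (E^`() + E * (powgen x K - powgen y K))`_k.+1 = 0.
  by move: main => /dvdpP[q ->]; rewrite coefMXn /K ltnSn.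
rewrite coefD coef_deriv E2 ?(ltnW (ltnSn _)) // coefM 2!big_ord_recl /=.
rewrite E0 E1 mul0r add0r mul1r coefB !coefpow ?subn0 //.
rewrite (eq_bigr (fun m : 'I_k => - (resmom m * hdiff (k - m)))); last first.
  move=> m _; rewrite /bump !leq0n !add1n E2; last by have := ltn_ord m; rewrite /K; lia.
  rewrite coefB !coefpow ?subSS; [|rewrite /K; lia..].
  by rewrite -/(hdiff _) subnSK // mulNr.
rewrite sumrN -/(hdiff _) mulNrn -mulr_natl => /eqP; rewrite addrC addr_eq0 => /eqP e.
by rewrite e opprK mulr1 mulr_natl.
Qed.

End Residues.

(** * The cotransition measure *)

Section Cotransition.
Variable R : realType.
Local Notation content := (content R).

(* With [c = content nu] this is [|nu| dim (nu - e_i) / dim nu], and [0] when row [i] has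
   no removable box. *)
Definition rho (N : nat) (c : nat -> R) (i : 'I_N) : R :=
  res (fun k : 'I_N.+1 => c k + 1) (fun k : 'I_N => c k) i.

(** With [d = c j - c i], lowering [c i] by one changes one factor of the numerator from [d - 1] to
    [d] and one of the denominator from [d] to [d + 1]. *)
Lemma rho_shift N (c c' : nat -> R) (i j : 'I_N) :
  (forall k, c' k = c k - (k == i)%:R) -> i != j ->
  (forall k : 'I_N, k != j -> c k != c j) -> c j - c i != 1 -> c j - c i != - 1 ->
  ((c j - c i) ^+ 2 - 1) * rho c' j = (c j - c i) ^+ 2 * rho c j.
Proof.
move=> hc ij cinj d1 dN1; rewrite /rho /res.
have cj : c' j = c j by rewrite hc eq_sym (negbTE (ij : (i : nat) != j)) subr0.
have ci : c' i = c i - 1 by rewrite hc eqxx.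
set i' : 'I_N.+1 := widen_ord (leqnSn N) i.
rewrite !(bigD1 i' (P := predT)) //= !(bigD1 (P := fun k => k != j) i) //= cj ci.
rewrite (eq_bigr (fun k : 'I_N.+1 => c j - (c k + 1))); last first.
  by move=> k hk; rewrite hc (negbTE (hk : (k : nat) != i)) subr0.
rewrite [X in _ / (_ * X)](eq_bigr (fun k : 'I_N => c j - c k)); last first.
  by move=> k /andP[_ hk]; rewrite hc (negbTE (hk : (k : nat) != i)) subr0.
set A := \prod_(_ < _ | _) _; set B := \prod_(_ < _ | _) _.
have B0 : B != 0.
  by apply/prodf_neq0 => k /andP[kj _]; rewrite subr_eq0 eq_sym cinj.
have e0 : c j - c i != 0 by rewrite subr_eq0 eq_sym cinj.
have e1 : c j - (c i - 1) != 0.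
  by apply: contra dN1 => /eqP e; apply/eqP; lra.
by field; rewrite B0 e0 e1.
Qed.

Lemma content_lt la i j : (i < j)%N -> content la j < content la i.
Proof.
move=> ij; have h : (rowl la j)%:R <= (rowl la i)%:R :> R by rewrite ler_nat rowl_anti // ltnW.
have h2 : (i%:R : R) < j%:R by rewrite ltr_nat.
rewrite /content; lra.
Qed.

Lemma content_inj la i j : content la i = content la j -> i = j.
Proof.
move=> e; case: (ltngtP i j) => // h; have := content_lt la h; rewrite e ltxx //.
Qed.

Lemma content_yrem nu i k : removable nu i ->
  content (yrem nu i) k = content nu k - (k == i)%:R.
Proof.
move=> h; rewrite /content rowl_yrem //; case: (k =P i) => [->|_] /=; last by rewrite subn0 subr0.
by rewrite natrB ?removable_rowl_gt0 //; ring.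
Qed.

(** Row [i + 1] is as long as row [i], so [x_(i+1) = y_i] and a factor of the numerator vanishes. *)
Lemma rho_eq0 N nu (i : 'I_N) : ~~ removable nu i -> rho (content nu) i = 0.
Proof.
rewrite /removable -leqNgt => h.
have e : rowl nu i.+1 = rowl nu i by have := rowl_anti nu (leqnSn i); lia.
rewrite /rho /res (bigD1 (lift ord0 i)) //= /bump leq0n add1n /content e.
rewrite (_ : _ - _ = 0) ?mul0r ?oppr0 ?mul0r //.
by rewrite -natr1; ring.
Qed.

Lemma removable_yrem nu i j : i != j -> removable nu i -> removable nu j -> removable (yrem nu i) j.
Proof.
rewrite /removable => ij hi hj; rewrite !rowl_yrem // (eq_sym j) (negbTE ij); lia.
Qed.

Lemma yrem_comm nu i j : i != j -> removable nu i -> removable nu j ->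
  yrem (yrem nu i) j = yrem (yrem nu j) i.
Proof.
move=> ij hi hj; apply: rowl_inj => k.
have ji : j != i by rewrite eq_sym.
rewrite !rowl_yrem ?removable_yrem //; lia.
Qed.

Lemma ysize_yrem nu i : removable nu i -> ysize nu = (ysize (yrem nu i)).+1.
Proof. by move=> h; apply: yarrow_size (yarrow_yrem h). Qed.

Definition xcont la N (k : 'I_N.+1) : R := content la k + 1.
Definition ycont la N (k : 'I_N) : R := content la k.
Arguments xcont : clear implicits. Arguments ycont : clear implicits.

Lemma ycont_inj la N : injective (ycont la N).
Proof. by move=> i j /content_inj/val_inj. Qed.

Lemma last_xcont la N : (size (rows la) <= N)%N -> content la N + 1 = - N%:R.
Proof. by move=> h; rewrite /content rowl_default //; ring. Qed.

(** Each [x_k] with [k < N] exceeds [y_k] by one, and the extra [x_N = -N] compensates. *)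
Lemma sum_xycont la N : (size (rows la) <= N)%N ->
  \sum_k xcont la N k = \sum_k ycont la N k.
Proof.
move=> h; rewrite big_ord_recr /= /xcont last_xcont // /ycont big_split /=.
by rewrite sumr_const card_ord addrK.
Qed.

Lemma sum_odd (N : nat) : \sum_(k < N) (2 * k%:R + 1) = N%:R ^+ 2 :> R.
Proof. by elim: N => [|N IH]; [rewrite big_ord0 expr0n | rewrite big_ord_recr /= IH -natr1; ring]. Qed.

(** Row [k] gives [2 y_k + 1], and [N^2] is spread over the rows as the sum of the [2 k + 1];
    together they make twice the row length. *)
Lemma hdiff2 la N : (size (rows la) <= N)%N ->
  hdiff (xcont la N) (ycont la N) 2 = 2 * (ysize la)%:R.
Proof.
move=> h; rewrite /hdiff big_ord_recr /= /xcont last_xcont // sqrrN -sum_odd.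
rewrite addrAC -sumrB -big_split /= (ysizeE h) natr_sum big_distrr /=.
by apply: eq_bigr => k _; rewrite /ycont /content; ring.
Qed.

Lemma sum_rho la N : (size (rows la) <= N)%N -> \sum_(i < N) rho (content la) i = (ysize la)%:R.
Proof.
move=> h; have := newton_res (@ycont_inj la N) (sum_xycont h) 0.
rewrite big_ord0 subr0 hdiff2 // => /(mulfI _) e; rewrite -e ?pnatr_eq0 //.
by apply: eq_bigr => i _; rewrite expr0 mulr1.
Qed.

Lemma ydim_rec nu N : (size (rows nu) <= N)%N -> (0 < ysize nu)%N ->
  ydim nu = (\sum_(i < N | removable nu i) ydim (yrem nu i))%N.
Proof.
by move=> h n0; rewrite {1}/ydim dimr_rec // (sum_down _ h).
Qed.

(* Two removable corners [i], [j]: by induction the ratio is known for [nu - e_i] and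
   [nu - e_j], and [rho_i(nu) rho_j(nu - e_i)] is symmetric in [i], [j]; so
   [rho_i(nu) : dim (nu - e_i)] does not depend on [i], and [sum_i rho_i = |nu|]. *)
Lemma dim_ratio N nu (i : 'I_N) : (size (rows nu) <= N)%N -> removable nu i ->
  (ysize nu)%:R * (ydim (yrem nu i))%:R = rho (content nu) i * (ydim nu)%:R.
Proof.
have [n] := ubnP (ysize nu); elim: n nu i => // n IH nu i hn hN hi.
have key (j : 'I_N) : removable nu j ->
    rho (content nu) i * (ydim (yrem nu j))%:R = rho (content nu) j * (ydim (yrem nu i))%:R.
  move=> hj; case: (eqVneq i j) => [->//|ij].
  have ji : j != i by rewrite eq_sym.
  have sz (k : 'I_N) : removable nu k -> (size (rows (yrem nu k)) <= N)%N.
    by move=> hk; apply: leq_trans (size_rows_mono _) hN => l; rewrite rowl_yrem //; lia.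
  have rij := removable_yrem (ij : (i : nat) != j) hi hj.
  have rji := removable_yrem (ji : (j : nat) != i) hj hi.
  have IHi := IH (yrem nu i) j _ (sz i hi) rij.
  have IHj := IH (yrem nu j) i _ (sz j hj) rji.
  have si := ysize_yrem hi; have sj := ysize_yrem hj.
  move: IHi IHj; rewrite (yrem_comm (ij : (i : nat) != j)) //.
  have e : ysize (yrem nu j) = ysize (yrem nu i) by lia.
  rewrite e => /(_ ltac:(lia)) IHi /(_ ltac:(lia)) IHj.
  have s2 := ysize_yrem rji.
  set D := (ydim (yrem (yrem nu j) i))%:R in IHi IHj.
  have D0 : D != 0 by rewrite pnatr_eq0 -lt0n ydim_gt0.
  have m0 : (ysize (yrem nu i))%:R != 0 :> R by rewrite pnatr_eq0 -e s2.
  set d := content nu j - content nu i.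
  (* The lower of two removable rows is strictly shorter, so the contents of the two corners differ
     by at least 2. *)
  have step (a b : 'I_N) : a != b -> removable nu a -> removable nu b ->
      content nu b - content nu a != 1.
    move=> ab ha hb; apply/negP => /eqP ee.
    case: (ltngtP a b) => [lt|lt|/val_inj eab]; last by rewrite eab eqxx in ab.
      by have := content_lt nu lt; lra.
    move: hb; rewrite /removable => hb.
    have h1 : (rowl nu a)%:R + 1 <= (rowl nu b)%:R :> R.
      by rewrite natr1 ler_nat; have := rowl_anti nu lt; lia.
    have h2 : (b%:R : R) + 1 <= a%:R by rewrite natr1 ler_nat.
    by move: ee; rewrite /content; lra.
  have d1 : d != 1 by exact: step.
  have dN1 : d != -1.
    by rewrite -eqr_oppLR /d opprB; apply: step.
  have cinj (b k : 'I_N) : k != b -> content nu k != content nu b.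
    by apply: contra => /eqP/content_inj/val_inj ->.
  have r1 := @rho_shift N (content nu) (content (yrem nu i)) i j (fun k => content_yrem k hi) ij (cinj j) d1 dN1.
  have r2 := @rho_shift N (content nu) (content (yrem nu j)) j i (fun k => content_yrem k hj) ji (cinj i).
  rewrite -/d in r1; rewrite -opprB -/d eqr_oppLR eqr_opp sqrrN in r2.
  have {}r2 := r2 dN1 d1.
  have d2 : d ^+ 2 - 1 != 0.
    by rewrite subr_sqr_1 mulf_neq0 // ?subr_eq0 // addr_eq0.
  have d0 : d ^+ 2 != 0 by rewrite sqrf_eq0 subr_eq0; apply: cinj.
  (* Multiplying by these nonzero factors makes room for the induction hypotheses and [rho_shift];
     the latter brings in only [d^2], which is symmetric in [i] and [j]. *)
  apply: (mulfI d0); apply: (mulfI m0); apply: (mulfI D0).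
  rewrite (_ : D * _ = (d ^+ 2 * rho (content nu) i) * ((ysize (yrem nu i))%:R * D) * (ydim (yrem nu j))%:R); last by ring.
  rewrite IHi -r2.
  rewrite [RHS](_ : _ = (d ^+ 2 * rho (content nu) j) * ((ysize (yrem nu i))%:R * D) * (ydim (yrem nu i))%:R); last by ring.
  by rewrite IHj -r1; ring.
have n0 : (0 < ysize nu)%N by rewrite (ysize_yrem hi).
rewrite (ydim_rec hN n0) natr_sum big_distrr /=.
rewrite (eq_bigr (fun j : 'I_N => rho (content nu) j * (ydim (yrem nu i))%:R)); last first.
  by move=> j hj; apply: key.
rewrite -big_distrl /= -(sum_rho hN) (bigID (fun j : 'I_N => removable nu j)) /=.
by rewrite [X in _ + X]big1 ?addr0 // => j; apply: rho_eq0.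
Qed.

(* [|nu|] times the expectation of [G nu c], where [c] is the content of the box removed
   by the down transition. *)
Definition Avg (G : ydiag -> R -> R) (nu : ydiag) : R :=
  (ysize nu)%:R * \sum_(la <- Yn (ysize nu).-1 | yarrow la nu)
     (ydim la)%:R / (ydim nu)%:R * G nu (csum R nu - csum R la).

(** [dim_ratio] trades dimensions for residues. Rows without a removable box can stay in the sum, as
    their [rho] is zero. *)
Lemma AvgE G nu N : (size (rows nu) <= N)%N ->
  Avg G nu = \sum_(i < N) rho (content nu) i * G nu (content nu i).
Proof.
move=> hN; rewrite /Avg (sum_down _ hN) big_distrr /=.
rewrite [RHS](bigID (fun j : 'I_N => removable nu j)) /= [X in _ + X]big1 ?addr0; last first.
  by move=> j /rho_eq0 ->; rewrite mul0r.
apply: eq_bigr => i hi; rewrite mulrA mulrA (dim_ratio hN hi) mulfK ?csum_yrem //.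
by rewrite pnatr_eq0 -lt0n ydim_gt0.
Qed.

Definition cotmom (k : nat) : ydiag -> R := Avg (fun _ c => c ^+ k).
Definition hcorner (k : nat) (la : ydiag) : R :=
  hdiff (xcont la (size (rows la))) (ycont la (size (rows la))) k.

Lemma cotmom_newton k la :
  k.+2%:R * cotmom k la = hcorner k.+2 la - \sum_(m < k) cotmom m la * hcorner (k - m) la.
Proof.
rewrite /cotmom !(AvgE _ (leqnn _)).
rewrite (eq_bigr (fun m : 'I_k => resmom (xcont la (size (rows la))) (ycont la (size (rows la))) m * hcorner (k - m) la)).
  exact: newton_res (@ycont_inj la _) (sum_xycont (leqnn _)) k.
by move=> m _; rewrite (AvgE _ (leqnn _)).
Qed.

Definition bcoef (k l : nat) : R := ('C(k, l))%:R * (onehalf R ^+ (k - l) - (- onehalf R) ^+ (k - l)).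

Lemma boxdiffE k (c : R) : boxdiff k c = \sum_(l < k) bcoef k l * c ^+ l.
Proof.
rewrite /boxdiff addrC (addrC c) (addrC c) !exprDn [X in _ + X]big_ord_recr [X in - X]big_ord_recr /=.
rewrite !subnn !expr0 addrC opprD addrACA subrr addr0 -sumrB.
by apply: eq_bigr => l _; rewrite /bcoef -mulrnBl -mulrBl mulr_natl mulrnAl.
Qed.

Lemma bcoef_top k : bcoef k.+1 k = k.+1%:R.
Proof. by rewrite /bcoef binSn subSnn !expr1 /onehalf; field. Qed.

(** Differences [x^j - y^j] are values of [boxdiff j] at half-shifted contents; expanded by
    [boxdiffE], they match [pk_rows] term by term, and the constant terms cancel. *)
Lemma hcornerE j la : (0 < j)%N ->
  hcorner j la = \sum_(l < j.-1) bcoef j l.+1 * pk R l.+1 la.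
Proof.
move=> j0; set N := size (rows la).
have -> : hcorner j la = \sum_(k < N) (boxdiff j (content la k + onehalf R) - boxdiff j (- k%:R - onehalf R)).
  (* The unpaired value [x_N = -N] is spread over the rows by telescoping. *)
  have tel : (- N%:R) ^+ j = - \sum_(k < N) boxdiff j (- k%:R - onehalf R) :> R.
    rewrite -(big_mkord predT (fun k => boxdiff j (- k%:R - onehalf R))) -sumrN.
    rewrite (eq_bigr (fun k : nat => (- k.+1%:R) ^+ j - (- k%:R) ^+ j)).
      by rewrite telescope_sumr // oppr0 expr0n (gtn_eqF j0) subr0.
    move=> k _; rewrite /boxdiff opprB; congr (_ ^+ _ - _ ^+ _); rewrite -?natr1 /onehalf; by field.
  rewrite /hcorner /hdiff -/N big_ord_recr /= /xcont last_xcont // tel addrAC -!sumrB.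
  apply: eq_bigr => k _; congr (_ - _); rewrite /boxdiff /ycont.
  by congr (_ ^+ _ - _ ^+ _); rewrite /onehalf; field.
rewrite (eq_bigr (fun k : 'I_N => \sum_(l < j) bcoef j l * ((content la k + onehalf R) ^+ l - (- k%:R - onehalf R) ^+ l))); last first.
  by move=> k _; rewrite !boxdiffE -sumrB; apply: eq_bigr => l _; rewrite mulrBr.
rewrite exchange_big -[in LHS](prednK j0) big_ord_recl /= big1 ?add0r; last first.
  by move=> k _; rewrite !expr0 subrr mulr0.
apply: eq_bigr => l _; rewrite /bump leq0n add1n -big_distrr /= (@pk_rows R l.+1 la N) // prednK //.
Qed.

End Cotransition.

(** * The degree filtration *)

Section Filtration.
Variable R : realType.
Local Notation fn := (ydiag -> R).

Definition pmon (s : seq nat) (la : ydiag) : R := \prod_(k <- s) pk R k la.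

(* [W d]: elements of Lambda of degree [< d], where [p_k] has degree [k]; in
   particular [W 0] only contains [0]. *)
Inductive W : nat -> fn -> Prop :=
| W_zero d : W d (fun _ => 0)
| W_cons d a s f : all (leq 1) s -> (sumn s < d)%N -> W d f ->
    W d (fun la => a * pmon s la + f la).

Lemma W_ext d f g : f =1 g -> W d f -> W d g.
Proof. by move=> /funext ->. Qed.

Lemma W_le d e f : (d <= e)%N -> W d f -> W e f.
Proof.
move=> de wf; elim: wf de => {d f} [d|d a s f ps sd _ IH] de; first exact: W_zero.
by apply: W_cons => //; [exact: leq_trans de | exact: IH].
Qed.

Lemma W_add d f g : W d f -> W d g -> W d (fun la => f la + g la).
Proof.
move=> wf wg; elim: wf wg => {d f} [d|d a s f ps sd _ IH] wg.
  by apply: W_ext wg => la; rewrite add0r.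
apply: (W_ext _ (W_cons a ps sd (IH wg))) => la; rewrite addrA //.
Qed.

Lemma W_scale d c f : W d f -> W d (fun la => c * f la).
Proof.
elim=> {d f} [d|d a s f ps sd _ IH].
  by apply: (W_ext _ (W_zero d)) => la; rewrite mulr0.
by apply: (W_ext _ (W_cons (c * a) ps sd IH)) => la; rewrite mulrDr mulrA.
Qed.

Lemma W_sub d f g : W d f -> W d g -> W d (fun la => f la - g la).
Proof.
move=> wf wg; apply: (W_ext _ (W_add wf (W_scale (-1) wg))) => la; by rewrite mulN1r.
Qed.

Lemma W_sum d (n : nat) (f : 'I_n -> fn) :
  (forall i, W d (f i)) -> W d (fun la => \sum_i f i la).
Proof.
elim: n f => [|n IH] f wf.
  by apply: (W_ext _ (W_zero d)) => la; rewrite big_ord0.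
apply: (W_ext _ (W_add (wf ord0) (IH (fun i => f (lift ord0 i)) (fun i => wf _)))) => la.
by rewrite big_ord_recl.
Qed.

Lemma W_pmon d s : all (leq 1) s -> (sumn s < d)%N -> W d (pmon s).
Proof.
move=> ps sd; apply: (W_ext _ (W_cons 1 ps sd (W_zero d))) => la.
by rewrite mul1r addr0.
Qed.

Lemma W_const d c : (0 < d)%N -> W d (fun _ => c).
Proof.
move=> d0; apply: (W_ext _ (W_cons c (isT : all (leq 1) [::]) d0 (W_zero d))) => la.
by rewrite /pmon big_nil mulr1 addr0.
Qed.

Lemma W_pk k d : (0 < k)%N -> (k < d)%N -> W d (pk R k).
Proof.
move=> k0 kd; apply: (@W_ext _ (pmon [:: k])); first by move=> la; rewrite /pmon big_seq1.
by apply: W_pmon; rewrite /= ?k0 ?addn0.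
Qed.

(** The bounds are strict: degrees at most [d - 1] and [e - 1] add up to at most [d + e - 2]. *)
Lemma W_mul d e f g : W d f -> W e g -> W (d + e).-1 (fun la => f la * g la).
Proof.
move=> wf wg; elim: wf => {d f} [d|d a s f ps sd _ IH].
  by apply: (W_ext _ (W_zero _)) => la; rewrite mul0r.
apply: (@W_ext _ (fun la => a * pmon s la * g la + f la * g la)).
  by move=> la; rewrite mulrDl.
apply: W_add IH; elim: wg => {e g} [e|e b t g pt te _ IH].
  by apply: (W_ext _ (W_zero _)) => la; rewrite mulr0.
have pst : all (leq 1) (s ++ t) by rewrite all_cat ps.
have dst : (sumn (s ++ t) < (d + e).-1)%N by rewrite sumn_cat; lia.
apply: (W_ext _ (W_cons (a * b) pst dst IH)) => la.
by rewrite /pmon big_cat /=; ring.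
Qed.

Lemma W0 f : W 0 f -> forall la, f la = 0.
Proof. by move E : 0%N => d wf; case: wf E => // {}d a s g _ h _ e; move: h; rewrite -e ltn0. Qed.

Lemma inLam_W f : inLam f -> exists d, W d f.
Proof.
elim=> {f} [c|k k0|f g _ [d wf] _ [e wg]|f g _ [d wf] _ [e wg]].
- by exists 1%N; apply: W_const.
- by exists k.+1; apply: W_pk.
- by exists (maxn d e); apply: W_add; [apply: W_le wf | apply: W_le wg]; rewrite ?leq_maxl ?leq_maxr.
by exists (d + e).-1; apply: W_mul.
Qed.

Lemma W_inLam d f : W d f -> inLam f.
Proof.
elim=> {d f} [d|d a s f ps _ _ IH]; first exact: Lam_const.
apply: Lam_add IH; apply: Lam_mul; first exact: Lam_const.
rewrite /pmon; elim: s ps => [_|k s IHs /= /andP[k0 /IHs h]].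
  by rewrite (_ : (fun _ => _) = (fun _ => 1)); [exact: Lam_const | apply/funext => la; rewrite big_nil].
rewrite (_ : (fun _ => _) = (fun la => pk R k la * \prod_(j <- s) pk R j la)).
  by apply: Lam_mul => //; apply: Lam_p.
by apply/funext => la; rewrite big_cons.
Qed.

Lemma W_hcorner j : (0 < j)%N -> W j (hcorner R j).
Proof.
move=> j0; rewrite (funext (fun la => hcornerE R la j0)).
apply: W_sum => l; apply: W_scale; apply: W_pk => //; have := ltn_ord l; lia.
Qed.

(** In Newton's recursion [hcorner k.+2] has degree at most [k + 1], and the products at most
    [(m + 1) + (k - m - 1) = k]. *)
Lemma W_cotmom k : W k.+2 (cotmom R k).
Proof.
have [n] := ubnP k; elim: n k => // n IH k kn.
have -> : cotmom R k = (fun la => k.+2%:R^-1 * (hcorner R k.+2 la - \sum_(m < k) cotmom R m la * hcorner R (k - m) la)).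
  by apply/funext => la; rewrite -cotmom_newton mulKf // pnatr_eq0.
apply: W_scale; apply: W_sub; first exact: W_hcorner.
apply: W_sum => m; have mk := ltn_ord m.
apply: (@W_le (m.+2 + (k - m)).-1); first lia.
by apply: W_mul; [apply: IH; lia | apply: W_hcorner; lia].
Qed.

(** Only the last term [(k + 2) p_(k+1)] of [hcorner k.+2] reaches degree [k + 1]. *)
Lemma W_cotmom_top k : W k.+1 (fun la => cotmom R k la - pk R k.+1 la).
Proof.
have -> : (fun la => cotmom R k la - pk R k.+1 la) =
  (fun la => k.+2%:R^-1 * (\sum_(l < k) bcoef R k.+2 l.+1 * pk R l.+1 la
                          - \sum_(m < k) cotmom R m la * hcorner R (k - m) la)).
  apply/funext => la.
  have := cotmom_newton R k la; rewrite hcornerE // big_ord_recr /= bcoef_top => e.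
  have k2 : k.+2%:R != 0 :> R by rewrite pnatr_eq0.
  by apply: (mulfI k2); rewrite mulVKf // mulrBr e; ring.
apply: W_scale; apply: W_sub; apply: W_sum => m; have mk := ltn_ord m.
  by apply: W_scale; apply: W_pk; lia.
apply: (@W_le (m.+2 + (k - m)).-1); first lia.
by apply: W_mul; [apply: W_cotmom | apply: W_hcorner; lia].
Qed.

(* Functions of a diagram and of the content [c] of one of its removable boxes,
   polynomial in [c], of total degree [< d]. *)
Inductive V : nat -> (ydiag -> R -> R) -> Prop :=
| V_zero d : V d (fun _ _ => 0)
| V_cons d a j e G : W e a -> (0 < e)%N -> (e + j <= d)%N -> V d G ->
    V d (fun nu c => a nu * c ^+ j + G nu c).

Lemma V_ext d G H : (forall nu c, G nu c = H nu c) -> V d G -> V d H.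
Proof. by move=> e; rewrite (_ : G = H) //; apply/funext => nu; apply/funext => c. Qed.

Lemma V_le d e G : (d <= e)%N -> V d G -> V e G.
Proof.
move=> de vG; elim: vG de => {d G} [d|d a j i G wa i0 ij _ IH] de; first exact: V_zero.
by apply: V_cons wa i0 _ (IH de); apply: leq_trans de.
Qed.

Lemma V_add d G H : V d G -> V d H -> V d (fun nu c => G nu c + H nu c).
Proof.
move=> vG vH; elim: vG vH => {d G} [d|d a j i G wa i0 ij _ IH] vH.
  by apply: V_ext vH => nu c; rewrite add0r.
by apply: (V_ext _ (V_cons wa i0 ij (IH vH))) => nu c; rewrite addrA.
Qed.

Lemma V_term d e a j : W e a -> (0 < e)%N -> (e + j <= d)%N -> V d (fun nu c => a nu * c ^+ j).
Proof.
move=> wa e0 ej; apply: (V_ext _ (V_cons wa e0 ej (V_zero d))) => nu c.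
by rewrite addr0.
Qed.

Lemma V_sum d (n : nat) (G : 'I_n -> ydiag -> R -> R) :
  (forall i, V d (G i)) -> V d (fun nu c => \sum_i G i nu c).
Proof.
elim: n G => [|n IH] G vG.
  by apply: (V_ext _ (V_zero d)) => nu c; rewrite big_ord0.
apply: (V_ext _ (V_add (vG ord0) (IH (fun i => G (lift ord0 i)) (fun i => vG _)))) => nu c.
by rewrite big_ord_recl.
Qed.

Lemma V_mul d e G H : V d G -> V e H -> V (d + e).-1 (fun nu c => G nu c * H nu c).
Proof.
move=> vG vH; elim: vG => {d G} [d|d a j i G wa i0 ij _ IH].
  by apply: (V_ext _ (V_zero _)) => nu c; rewrite mul0r.
apply: (@V_ext _ (fun nu c => a nu * c ^+ j * H nu c + G nu c * H nu c)).
  by move=> nu c; rewrite mulrDl.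
apply: V_add IH; elim: vH => {e H} [e|e b k l H wb l0 lk _ IH].
  by apply: (V_ext _ (V_zero _)) => nu c; rewrite mulr0.
apply: (V_ext _ (V_cons (j := j + k) (W_mul wa wb) _ _ IH)); [|lia|lia].
by move=> nu c; rewrite exprD; ring.
Qed.

Lemma Avg_add (G H : ydiag -> R -> R) nu :
  Avg (fun nu c => G nu c + H nu c) nu = Avg G nu + Avg H nu.
Proof.
by rewrite /Avg -mulrDr -big_split /=; congr (_ * _); apply: eq_bigr => la _; rewrite mulrDr.
Qed.

Lemma Avg_scale (a : fn) (G : ydiag -> R -> R) nu :
  Avg (fun nu c => a nu * G nu c) nu = a nu * Avg G nu.
Proof.
rewrite /Avg mulrCA; congr (_ * _); rewrite big_distrr /=; apply: eq_bigr => la _; ring.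
Qed.

(** Averaging raises the degree by at most one: [c^j] counts for [j], its average [cotmom j] for
    [j + 1]. *)
Lemma Avg_W d G : V d G -> W d.+1 (Avg G).
Proof.
elim=> {d G} [d|d a j e G wa e0 ej _ IH].
  apply: (W_ext _ (W_zero _)) => nu; rewrite /Avg big1 ?mulr0 // => la _.
  by rewrite mulr0.
apply: (@W_ext _ (fun nu => a nu * cotmom R j nu + Avg G nu)).
  by move=> nu; rewrite Avg_add Avg_scale.
apply: W_add IH; apply: (@W_le (e + j.+2).-1); first lia.
by apply: W_mul => //; apply: W_cotmom.
Qed.

(** On level [n + 1] this is [(n + 1) D_{n+1,n} f]; at the empty diagram the factor [ysize nu] makes
    it zero. *)
Definition Tdown (f : fn) (nu : ydiag) : R := (ysize nu)%:R * Dop (ysize nu).-1 f nu.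
Definition Nop (f : fn) (nu : ydiag) : R := (ysize nu)%:R * f nu - Tdown f nu.

Lemma ydim_neq0 la : (ydim la)%:R != 0 :> R.
Proof. by rewrite pnatr_eq0 -lt0n ydim_gt0. Qed.

Lemma TdownE f nu : Tdown f nu = (ysize nu)%:R *
  \sum_(la <- Yn (ysize nu).-1 | yarrow la nu) (ydim la)%:R / (ydim nu)%:R * f la.
Proof.
rewrite /Tdown /Dop [in RHS]big_mkcond; congr (_ * _); apply: eq_bigr => la _.
by rewrite /pdown; case: ifP => // _; rewrite mul0r.
Qed.

Lemma sum_pdown nu : (0 < ysize nu)%N ->
  \sum_(la <- Yn (ysize nu).-1 | yarrow la nu) (ydim la)%:R / (ydim nu)%:R = 1 :> R.
Proof.
move=> n0; rewrite -big_distrl /= -natr_sum -dimr_rec // divff //; exact: ydim_neq0.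
Qed.

(** The down probabilities sum to one, so [Nop f] is [|nu|] times the mean decrement of [f] when a
    box is removed. *)
Lemma NopE f G nu :
  (forall la, yarrow la nu -> f la = f nu - G nu (csum R nu - csum R la)) ->
  Nop f nu = Avg G nu.
Proof.
move=> h; rewrite /Nop TdownE.
case: (posnP (ysize nu)) => [e|n0]; first by rewrite /Avg e !mul0r subrr.
rewrite /Avg -mulrBr; congr (_ * _).
rewrite -[X in X - _]mul1r -[X in X * _ - _](sum_pdown n0) big_distrl /= -sumrB.
by apply: eq_bigr => la hla; rewrite (h la hla); ring.
Qed.

Lemma pk_arrow k la nu : (0 < k)%N -> yarrow la nu ->
  pk R k la = pk R k nu - boxdiff k (csum R nu - csum R la).
Proof.
move=> k0 /yarrow_remP[i hi ->]; set N := size (rows nu).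
have iN : (i < N)%N := removable_lt_size hi.
have sz : (size (rows (yrem nu i)) <= N)%N.
  by apply: size_rows_mono => l; rewrite rowl_yrem //; lia.
rewrite (pk_rows _ k0 sz) (pk_rows _ k0 (leqnn _)) csum_yrem // -/(content R nu i).
rewrite (bigD1 (Ordinal iN)) //= [in RHS](bigD1 (Ordinal iN)) //= content_yrem // eqxx.
rewrite (eq_bigr (fun j : 'I_N => (content R nu j + onehalf R) ^+ k - (- j%:R - onehalf R) ^+ k)); last first.
  by move=> j hj; rewrite content_yrem // (negbTE (hj : (j : nat) != i)) subr0.
rewrite /boxdiff (_ : content R nu i - 1%:R + onehalf R = content R nu i - onehalf R); last first.
  by rewrite /onehalf; field.
ring.
Qed.

Lemma V_boxdiff k : V k (fun _ c => boxdiff k c).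
Proof.
apply: (V_ext (G := fun _ c => \sum_(l < k) bcoef R k l * c ^+ l)).
  by move=> nu c; rewrite boxdiffE.
by apply: V_sum => l; apply: (V_term (W_const (bcoef R k l) (ltn0Sn 0))) => //=.
Qed.

(** The leading term of [boxdiff k c] is [k c^(k-1)], and [cotmom (k-1)] has leading term [p_k]. *)
Lemma W_Avg_boxdiff k : (0 < k)%N ->
  W k (fun nu => Avg (fun _ c => boxdiff k c) nu - k%:R * pk R k nu).
Proof.
case: k => // k _.
have e : Avg (fun _ c => boxdiff k.+1 c) =1
   (fun nu => \sum_(l < k.+1) bcoef R k.+1 l * cotmom R l nu).
  move=> nu; rewrite /Avg.
  under eq_bigr do rewrite boxdiffE big_distrr /=.
  rewrite exchange_big big_distrr; apply: eq_bigr => l _ /=.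
  rewrite /cotmom /Avg mulrCA; congr (_ * _); rewrite big_distrr /=.
  by apply: eq_bigr => la _; rewrite mulrCA.
apply: (@W_ext _ (fun nu => \sum_(l < k) bcoef R k.+1 l * cotmom R l nu
   + k.+1%:R * (cotmom R k nu - pk R k.+1 nu))).
  by move=> nu; rewrite e big_ord_recr /= bcoef_top; ring.
apply: W_add; last by apply: W_scale; apply: W_cotmom_top.
apply: W_sum => l; apply: W_scale; apply: W_le (W_cotmom l); have := ltn_ord l; lia.
Qed.

(** A discrete Leibniz rule, by induction on [s]: the decrement of a product is [G1 + G2 - G3]. The
    first two terms produce the eigenvalue [k + sumn s]; [G3], a product of two decrements, only
    contributes in lower degree. *)
Lemma pmon_arrow s : all (leq 1) s -> exists G,
  [/\ forall la nu, yarrow la nu -> pmon s la = pmon s nu - G nu (csum R nu - csum R la),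
      V (sumn s) G & W (sumn s) (fun nu => Avg G nu - (sumn s)%:R * pmon s nu)].
Proof.
elim: s => [_|k s IH /= /andP[k0 ps]].
  exists (fun _ _ => 0); split.
  - by move=> la nu _; rewrite /pmon !big_nil subr0.
  - exact: V_zero.
  apply: (W_ext _ (W_zero _)) => nu; rewrite /Avg mul0r subr0 big1 ?mulr0 // => la _.
  by rewrite mulr0.
have [G [hG vG wG]] := IH ps.
pose G1 nu (c : R) := pk R k nu * G nu c.
pose G2 nu (c : R) := pmon s nu * boxdiff k c.
pose G3 nu (c : R) := boxdiff k c * G nu c.
exists (fun nu c => (G1 nu c + G2 nu c) + (-1) * G3 nu c).
have v3 : V (k + sumn s).-1 G3 by apply: V_mul => //; apply: V_boxdiff.
have v1 : V (k + sumn s) G1.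
  apply: (@V_le (k.+1 + sumn s).-1); first lia.
  apply: V_mul => //; apply: (V_ext _ (V_term (j := 0) (W_pk k0 (leqnn k.+1)) _ _)) => //; last by rewrite addn0.
  by move=> nu c; rewrite expr0 mulr1.
have v2 : V (k + sumn s) G2.
  apply: (@V_le ((sumn s).+1 + k).-1); first lia.
  apply: V_mul; last exact: V_boxdiff.
  apply: (V_ext _ (V_term (j := 0) (W_pmon ps (leqnn (sumn s).+1)) _ _)) => //; last by rewrite addn0.
  by move=> nu c; rewrite expr0 mulr1.
split.
- move=> la nu h; rewrite /pmon !big_cons -!/(pmon _ _) (hG _ _ h) (pk_arrow k0 h) /G1 /G2 /G3; ring.
- apply: V_add; first exact: V_add.
  apply: (V_le (d := (0.+1 + (k + sumn s).-1).-1)); first lia.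
  apply: V_mul v3; apply: (V_ext _ (V_term (j := 0) (W_const (-1) (leqnn 1)) _ _)) => //.
  by move=> nu c; rewrite expr0 mulr1.
apply: (@W_ext _ (fun nu => (pk R k nu * (Avg G nu - (sumn s)%:R * pmon s nu)
    + pmon s nu * (Avg (fun _ c => boxdiff k c) nu - k%:R * pk R k nu)) - Avg G3 nu)).
  move=> nu; rewrite (Avg_add (fun nu c => G1 nu c + G2 nu c)) (Avg_add G1) (Avg_scale (fun _ => -1)).
  have -> : Avg G1 nu = pk R k nu * Avg G nu by exact: Avg_scale.
  have -> : Avg G2 nu = pmon s nu * Avg (fun _ c => boxdiff k c) nu by exact: Avg_scale.
  by rewrite /pmon big_cons natrD; ring.
apply: W_sub; last by apply: W_le (Avg_W v3); lia.
apply: W_add.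
  apply: (@W_le (k.+1 + sumn s).-1); first lia.
  by apply: W_mul => //; apply: W_pk.
apply: (@W_le ((sumn s).+1 + k).-1); first lia.
by apply: W_mul; [apply: W_pmon | apply: W_Avg_boxdiff].
Qed.

Lemma Nop_add f g nu : Nop (fun la => f la + g la) nu = Nop f nu + Nop g nu.
Proof.
rewrite /Nop !TdownE; under eq_bigr do rewrite mulrDr.
by rewrite big_split /=; ring.
Qed.

Lemma Nop_scale c f nu : Nop (fun la => c * f la) nu = c * Nop f nu.
Proof.
rewrite /Nop !TdownE mulrBr mulrCA; congr (_ - _); rewrite mulrCA; congr (_ * _).
by rewrite big_distrr /=; apply: eq_bigr => la _; rewrite mulrCA.
Qed.

(** [Nop] multiplies a monomial of degree [e] by [e] up to lower degree, so [Nop - d] kills the part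
    of degree [d]. *)
Lemma W_Nop d f : W d.+1 f -> W d (fun nu => Nop f nu - d%:R * f nu).
Proof.
move E : d.+1 => e wf; elim: wf E => {e f} [e|e a s f ps sd _ IH] de.
  apply: (W_ext _ (W_zero _)) => nu; rewrite mulr0 subr0.
  by rewrite /Nop TdownE big1 ?mulr0 ?subrr // => la _; rewrite mulr0.
have [G [hG vG wG]] := pmon_arrow ps.
have le : (sumn s <= d)%N by lia.
apply: (@W_ext _ (fun nu => a * ((Avg G nu - (sumn s)%:R * pmon s nu) + ((sumn s)%:R - d%:R) * pmon s nu)
   + (Nop f nu - d%:R * f nu))).
  move=> nu; rewrite Nop_add Nop_scale (@NopE (pmon s) G) //; last by move=> la; apply: hG.
  ring.
apply: W_add; last exact: IH.
apply: W_scale; apply: W_add; first exact: W_le wG.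
move: le; rewrite leq_eqVlt => /predU1P[->|lt].
  by apply: (W_ext _ (W_zero _)) => nu; rewrite subrr mul0r.
by apply: W_scale; apply: W_pmon.
Qed.

End Filtration.

(** * Frobenius-Schur functions *)

Section FrobeniusSchur.
Variable R : realType.
Local Notation fn := (ydiag -> R).

(** The branching rule sums the dimensions; the scalar is [(n+1) n^_m = (n+1-m) (n+1)^_m]. *)
Lemma Tdown_FS mu nu :
  Tdown (FS R mu) nu = ((ysize nu)%:R - (ysize mu)%:R) * FS R mu nu.
Proof.
rewrite TdownE; case: (posnP (ysize nu)) => [e|n0].
  rewrite /FS e mul0r; case: (posnP (ysize mu)) => [->|m0]; first by rewrite subrr mul0r.
  by rewrite ffact_small // !mul0r mulr0.
set m := ysize mu; set n := (ysize nu).-1.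
have en : ysize nu = n.+1 by rewrite /n prednK.
rewrite (eq_bigr (fun la => (n ^_ m)%:R / (ydim nu)%:R * (dimr mu la)%:R)); last first.
  move=> la /yarrow_size; rewrite en => -[e]; rewrite /FS -e -/m.
  by field; rewrite !ydim_neq0.
rewrite -big_distrr /= -natr_sum /FS -/m en.
case: (leqP m n) => mn; last first.
  rewrite ffact_small // !mul0r mulr0; move: mn; rewrite leq_eqVlt => /predU1P[<-|h].
    by rewrite subrr mul0r.
  by rewrite ffact_small // !mul0r mulr0.
have -> : (\sum_(la <- Yn n | yarrow la nu) dimr mu la)%N = dimr mu nu.
  by rewrite dimr_rec // en ltnS.
have -> : (n.+1%:R : R) - m%:R = (n.+1 - m)%:R by rewrite natrB // leqW.
rewrite !mulrA -!natrM -ffactSS ffactnSr [in RHS]mulnC !natrM; ring.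
Qed.

Lemma Nop_FS mu nu : Nop (FS R mu) nu = (ysize mu)%:R * FS R mu nu.
Proof. by rewrite /Nop Tdown_FS; ring. Qed.

Lemma FS_low mu nu : (ysize nu < ysize mu)%N -> FS R mu nu = 0.
Proof. by move=> h; rewrite /FS ffact_small // !mul0r. Qed.

Lemma FS_level mu nu : ysize nu = ysize mu -> nu != mu -> FS R mu nu = 0.
Proof. by move=> e ne; rewrite /FS dimr_eq // eq_sym (negbTE ne) mulr0 mul0r. Qed.

Lemma FS_diag mu : FS R mu mu != 0.
Proof.
rewrite /FS dimr_eq // eqxx ffactnn mulr1 mulf_neq0 ?invr_neq0 ?ydim_neq0 //.
by rewrite pnatr_eq0 -lt0n fact_gt0.
Qed.

Lemma Tdown_low m (g : fn) nu : (forall la, (ysize la < m)%N -> g la = 0) ->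
  (ysize nu <= m)%N -> Tdown g nu = 0.
Proof.
move=> h hn; rewrite TdownE; case: (posnP (ysize nu)) => [->|n0]; first by rewrite mul0r.
rewrite big1 ?mulr0 // => la /yarrow_size e; rewrite h ?mulr0 //; lia.
Qed.

(** Induction on the size: once [g] vanishes on smaller diagrams, [Tdown g nu = 0] and the equation
    reads [(|nu| - m) g nu = 0]. *)
Lemma ker_unique m (g : fn) : (forall nu, Nop g nu = m%:R * g nu) ->
  (forall nu, ysize nu = m -> g nu = 0) -> forall nu, g nu = 0.
Proof.
move=> hN hm nu; have [n] := ubnP (ysize nu); elim: n nu => // n IH nu hn.
case: (eqVneq (ysize nu) m) => [/hm //|ne].
have := hN nu; rewrite /Nop (@Tdown_low (ysize nu)) // ?subr0; last first.
  by move=> la hla; apply: IH; lia.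
move/eqP; rewrite -subr_eq0 -mulrBl mulf_eq0 subr_eq0 eqr_nat (negbTE ne) /=.
by move/eqP.
Qed.

(** Induction on [d]: for [f] of degree at most [d], the function [Nop f - d f] has lower degree and
    vanishes on the smaller diagrams, so it is zero. Then [f] is an eigenfunction vanishing on level
    [d], and [ker_unique] applies. *)
Lemma W_vanish d (f : fn) : W d f -> (forall la, (ysize la < d)%N -> f la = 0) ->
  forall la, f la = 0.
Proof.
elim: d f => [|d IH] f wf low; first exact: W0.
have low' la : (ysize la < d)%N -> f la = 0 by move=> h; apply: low; lia.
have kr : forall nu, Nop f nu - d%:R * f nu = 0.
  apply: IH; first exact: W_Nop.
  by move=> la h; rewrite /Nop (Tdown_low low') ?low' ?mulr0 ?subrr // ltnW.
apply: (@ker_unique d); first by move=> nu; apply/eqP; rewrite -subr_eq0 kr.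
by move=> nu e; apply: low; rewrite e.
Qed.

Lemma inLam_scale c (f : fn) : inLam f -> inLam (fun la => c * f la).
Proof. by move=> h; apply: Lam_mul => //; apply: Lam_const. Qed.

Lemma inLam_sub (f g : fn) : inLam f -> inLam g -> inLam (fun la => f la - g la).
Proof.
move=> hf hg; rewrite (_ : (fun la => f la - g la) = (fun la => f la + (-1) * g la)).
  by apply: Lam_add => //; apply: inLam_scale.
by apply/funext => la; rewrite mulN1r.
Qed.

(** The [N] contents of a diagram form a strictly decreasing list, so an inclusion of two such lists
    is an equality. *)
Lemma contents_sub N la mu : (size (rows la) <= N)%N -> (size (rows mu) <= N)%N ->
  (forall i : 'I_N, exists j : 'I_N, content R la i = content R mu j) -> la = mu.
Proof.
move=> hl hm h.
have srt ka : sorted (fun x y : R => y < x) (mkseq (content R ka) N).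
  apply/(sortedP 0) => i; rewrite size_mkseq => hi.
  by rewrite !nth_mkseq ?content_lt //; lia.
have un ka : uniq (mkseq (content R ka) N).
  rewrite map_inj_uniq ?iota_uniq // => i j; exact: content_inj.
have sub : {subset mkseq (content R la) N <= mkseq (content R mu) N}.
  move=> x /mapP[i' +  ->]; rewrite mem_iota add0n => /= hi.
  have [j ->] := h (Ordinal hi); apply/mapP; exists (j : nat) => //.
  by rewrite mem_iota add0n /=.
have [|_ eqi] := uniq_min_size (un la) sub; first by rewrite !size_mkseq.
have e : mkseq (content R la) N = mkseq (content R mu) N.
  apply: (irr_sorted_eq (leT := fun x y : R => y < x)) => //.
  by move=> a b c /= h1 h2; apply: lt_trans h2 h1.
apply: rowl_inj => i; case: (ltnP i N) => hi; last by rewrite !rowl_default // (leq_trans _ hi).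
have := congr1 (fun s => nth 0 s i) e; rewrite /= !nth_mkseq // /content => /eqP.
by rewrite !(inj_eq (addIr _)) eqr_nat => /eqP.
Qed.

(** Each [X^l] with [l > 0] is replaced by [p_l]; the constant term is dropped, as it cancels in
    [psumE]. *)
Definition psum (q : {poly R}) : fn := fun la => \sum_(l < (size q).-1) q`_l.+1 * pk R l.+1 la.

Lemma psumE q la N : (size (rows la) <= N)%N ->
  psum q la = \sum_(i < N) (q.[content R la i + onehalf R] - q.[- i%:R - onehalf R]).
Proof.
move=> hN; rewrite /psum.
under eq_bigr do rewrite (pk_rows _ (ltn0Sn _) hN) big_distrr /=.
rewrite exchange_big; apply: eq_bigr => i _ /=; rewrite !horner_coef -sumrB.
case: (size q) => [|n] /=; first by rewrite !big_ord0.
rewrite [RHS]big_ord_recl /= !expr0 subrr add0r; apply: eq_bigr => l _.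
by rewrite mulrBr.
Qed.

Lemma Lam_sum (n : nat) (f : 'I_n -> fn) :
  (forall i, inLam (f i)) -> inLam (fun la => \sum_i f i la).
Proof.
elim: n f => [|n IH] f h.
  by rewrite (_ : (fun _ => _) = (fun _ => 0)); [exact: Lam_const | apply/funext => la; rewrite big_ord0].
rewrite (_ : (fun _ => _) = (fun la => f ord0 la + \sum_(i < n) f (lift ord0 i) la)).
  by apply: Lam_add => //; apply: IH.
by apply/funext => la; rewrite big_ord_recl.
Qed.

(* A squared polynomial vanishing exactly at the shifted contents of [mu]. *)
Lemma Lam_separates la mu : la != mu -> exists f : fn, [/\ inLam f, f mu = 1 & f la = 0].
Proof.
move=> ne; pose N := maxn (size (rows la)) (size (rows mu)).
have hl : (size (rows la) <= N)%N by rewrite /N; lia.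
have hm : (size (rows mu) <= N)%N by rewrite /N; lia.
pose q : {poly R} := (\prod_(j < N) ('X - (content R mu j + onehalf R)%:P)) ^+ 2.
have inq : inLam (psum q).
  by apply: Lam_sum => l; apply: inLam_scale; apply: Lam_p.
have q0 x : (q.[x] == 0) = [exists j : 'I_N, x == content R mu j + onehalf R].
  rewrite /q horner_exp sqrf_eq0 horner_prod; apply/prodf_eq0/existsP => -[j].
    by move=> _; rewrite hornerXsubC subr_eq0 => h; exists j.
  by move=> h; exists j => //; rewrite hornerXsubC subr_eq0.
have qge x : 0 <= q.[x] by rewrite /q horner_exp sqr_ge0.
have dne : psum q mu - psum q la != 0.
  (* The values at [-i - 1/2] depend only on [N] and cancel. As [q >= 0], equality would force every
     content of [la] to be one of [mu]. *)
  rewrite !(@psumE q _ N) // !sumrB opprB addrA subrK subr_eq0.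
  rewrite [X in X == _]big1; last first.
    by move=> i _; apply/eqP; rewrite q0; apply/existsP; exists i.
  apply: contra ne => /eqP/esym/eqP; rewrite psumr_eq0; last by move=> i _; apply: qge.
  move=> /allP h; apply/eqP/(contents_sub hl hm) => i.
  have := h i (mem_index_enum i); rewrite q0 => /existsP[j /eqP /addIr e].
  by exists j.
exists (fun ka => (psum q mu - psum q la)^-1 * (psum q ka - psum q la)); split.
- by apply: inLam_scale; apply: inLam_sub => //; apply: Lam_const.
- by rewrite mulVf.
- by rewrite subrr mulr0.
Qed.

Lemma Lam_interpolates (s : seq ydiag) mu : exists f : fn,
  [/\ inLam f, f mu = 1 & forall la, la \in s -> la != mu -> f la = 0].
Proof.
elim: s => [|ka s [f [lf f1 f0]]].
  by exists (fun _ => 1); split => //; apply: Lam_const.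
case: (eqVneq ka mu) => [->|ne].
  exists f; split => // la; rewrite inE => /predU1P[->|]; [by rewrite eqxx | exact: f0].
have [g [lg g1 g0]] := Lam_separates ne.
exists (fun la => g la * f la); split; first exact: Lam_mul.
  by rewrite g1 f1 mulr1.
by move=> la; rewrite inE => /predU1P[-> _|h1 h2]; rewrite ?g0 ?mul0r // f0 // mulr0.
Qed.

(* Applying [Nop - (d-1)], ..., [Nop - (m+1)] to an element of Lambda that is a delta
   function on level [m] and vanishes below brings its degree down to [m]; it is
   then an eigenfunction of [Nop], hence proportional to [FS mu]. *)
Lemma W_FS_extract mu e (f : fn) a : W ((ysize mu).+1 + e) f -> a != 0 ->
  (forall la, (ysize la < ysize mu)%N -> f la = 0) -> f mu = a ->
  (forall la, ysize la = ysize mu -> la != mu -> f la = 0) ->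
  W (ysize mu).+1 (FS R mu).
Proof.
set m := ysize mu; elim: e f a => [|e IH] f a wf a0 low fmu lev.
  rewrite addn0 in wf.
  have kr : forall nu, Nop f nu - m%:R * f nu = 0.
    apply: (@W_vanish m); first exact: W_Nop.
    by move=> la h; rewrite /Nop (Tdown_low low) ?low ?mulr0 ?subrr // ltnW.
  pose g nu := f nu + (- (a / FS R mu mu)) * FS R mu nu.
  have g0 nu : g nu = 0.
    apply: (@ker_unique m) nu => nu.
      rewrite /g Nop_add Nop_scale Nop_FS mulrDr.
      by have := kr nu; move/eqP; rewrite subr_eq0 => /eqP ->; ring.
    move=> e; rewrite /g; case: (eqVneq nu mu) => [->|ne].
      by rewrite fmu mulNr divfK ?subrr // FS_diag.
    by rewrite lev // (FS_level e ne) mulr0 addr0.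
  apply: (@W_ext _ _ (fun nu => (FS R mu mu / a) * f nu)); last exact: W_scale.
  move=> nu; have := g0 nu; rewrite /g => /eqP; rewrite mulNr subr_eq0 => /eqP ->.
  by field; rewrite a0 FS_diag.
rewrite addnS in wf.
set d := (m.+1 + e)%N in wf.
have dm : (m%:R : R) - d%:R != 0.
  by rewrite subr_eq0 eqr_nat; apply/eqP; rewrite /d; lia.
(* [Tdown f] vanishes up to level [m], so [Nop - d] multiplies the values on level [m] by [m - d]
   and keeps the zeros below. *)
apply: (IH (fun nu => Nop f nu - d%:R * f nu) ((m%:R - d%:R) * a)).
- exact: W_Nop.
- by rewrite mulf_neq0.
- by move=> la h; rewrite /Nop (Tdown_low low) ?low ?mulr0 ?subrr // ltnW.
- by rewrite /Nop (Tdown_low low) // fmu subr0 mulrBl.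
by move=> la h ne; rewrite /Nop (Tdown_low low) ?h // lev // !mulr0 !subrr.
Qed.

Lemma W_FS mu : W (ysize mu).+1 (FS R mu).
Proof.
set m := ysize mu.
have [f [lf f1 f0]] := Lam_interpolates (flatten [seq Yn k | k <- iota 0 m.+1]) mu.
have hf la : (ysize la <= m)%N -> la != mu -> f la = 0.
  move=> h ne; apply: f0 => //; apply/flatten_mapP; exists (ysize la); last by rewrite mem_Yn.
  by rewrite mem_iota; lia.
have [d wd] := inLam_W lf.
apply: (@W_FS_extract mu d f 1) => //.
- by apply: W_le wd; lia.
- by rewrite oner_neq0.
- move=> la h; apply: hf; first exact: ltnW.
  by apply/eqP => e; move: h; rewrite e ltnn.
by move=> la e ne; apply: hf; rewrite ?e.
Qed.

Lemma FS_inLam mu : inLam (FS R mu).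
Proof. exact: W_inLam (W_FS mu). Qed.

(** Spanning by the [FS mu]: levels are cleared upwards by subtracting multiples of [FS mu] with
    [mu] on the current level, which vanish on lower levels and elsewhere on this one. Once all
    levels below [d] are cleared, [W_vanish] leaves zero. *)
Lemma Lam_FS_ind (P : fn -> Prop) : P (fun _ => 0) ->
  (forall c mu f, P f -> P (fun la => c * FS R mu la + f la)) ->
  forall f, inLam f -> P f.
Proof.
move=> P0 PS f /inLam_W[d wf].
have main j : forall k g, (j + k)%N = d -> W d g ->
    (forall la, (ysize la < k)%N -> g la = 0) -> P g.
  elim: j => [|j IH] k g.
    rewrite add0n => -> wg low; rewrite (_ : g = fun _ => 0) //.
    by apply/funext; apply: W_vanish low.
  move=> jk wg low.
  (* [s] lists the diagrams of level [k] where [h] may still be nonzero. *)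
  have gen (s : seq ydiag) : {subset s <= Yn k} -> uniq s ->
      (forall h, W d h -> (forall la, (ysize la < k)%N -> h la = 0) ->
         (forall la, la \notin s -> ysize la = k -> h la = 0) -> P h).
    elim: s => [|mu s IHs] sub; last move=> /= /andP[mus us].
      move=> _ h wh lowh lev; apply: (IH k.+1) => //; first by rewrite addnS -addSn.
      by move=> la; rewrite ltnS leq_eqVlt => /predU1P[e|]; [apply: lev | apply: lowh].
    move=> h wh lowh lev.
    have mk : ysize mu = k by apply/eqP; rewrite -mem_Yn; apply: sub; rewrite mem_head.
    pose c := h mu / FS R mu mu.
    pose h' la := h la + (- c) * FS R mu la.
    rewrite (_ : h = fun la => c * FS R mu la + h' la); last first.
      by apply/funext => la; rewrite /h'; ring.
    apply: PS; apply: IHs => //.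
    - by move=> x xs; apply: sub; rewrite inE xs orbT.
    - by apply: W_add => //; apply: W_scale; apply: W_le (W_FS mu); lia.
    - by move=> la hla; rewrite /h' lowh // FS_low ?mk // mulr0 addr0.
    move=> la las ek; rewrite /h'; case: (eqVneq la mu) => [->|ne].
      by rewrite /c mulNr divfK ?subrr // FS_diag.
    by rewrite lev ?FS_level ?mulr0 ?addr0 ?mk // inE negb_or ne.
  apply: (gen (Yn k)) => //; first exact: uniq_Yn.
  by move=> la + ek; rewrite mem_Yn ek eqxx.
by apply: (main d 0%N f); rewrite ?addn0.
Qed.

End FrobeniusSchur.

(** * The down and up operators *)

Section DownOperator.
Variable R : realType.
Local Notation fn := (ydiag -> R).

Lemma Tdown_inLam (f : fn) : inLam f -> inLam (Tdown f).
Proof.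
move=> lf; have [d wf] := inLam_W lf.
have wf' : W d.+1 f by apply: W_le wf.
have h := W_inLam (W_Nop wf').
rewrite (_ : Tdown f = fun nu => pk R 1 nu * f nu - (d%:R * f nu + (Nop f nu - d%:R * f nu))).
  apply: inLam_sub; first by apply: Lam_mul => //; apply: Lam_p.
  by apply: Lam_add => //; apply: inLam_scale.
by apply/funext => nu; rewrite pk1 /Nop; ring.
Qed.

Lemma is_Dtilde_Tdown : is_Dtilde (@Tdown R).
Proof.
split; first split.
- exact: Tdown_inLam.
- move=> a f g _ _; apply/funext => nu; rewrite !TdownE.
  under eq_bigr do rewrite mulrDr mulrCA.
  by rewrite big_split -big_distrr /=; ring.
by move=> n f _ nu e; rewrite /Tdown e /= mulKf // pnatr_eq0.
Qed.

Definition onerow (t : nat) : ydiag := ofrow (fun i => if i is 0 then t else 0)%N 1.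

Lemma rowl_onerow t : rowl (onerow t) =1 (fun i => if i is 0 then t else 0)%N.
Proof. by apply: rowl_ofrow => // -[|i]. Qed.

Lemma size_onerow t : (size (rows (onerow t)) <= 1)%N.
Proof. by rewrite leqNgt -rowl_gt0 rowl_onerow. Qed.

Lemma ysize_onerow t : ysize (onerow t) = t.
Proof. by rewrite (ysizeE (size_onerow t)) big_ord1 rowl_onerow. Qed.

Lemma Lam_onerow (f : fn) : inLam f -> exists p : {poly R}, forall t, f (onerow t) = p.[t%:R].
Proof.
elim=> {f} [c|k k0|f g _ [p hp] _ [q hq]|f g _ [p hp] _ [q hq]].
- by exists c%:P => t; rewrite hornerC.
- exists (('X - (onehalf R)%:P) ^+ k - ((- onehalf R) ^+ k)%:P) => t.
  rewrite (pk_rows _ k0 (size_onerow t)) big_ord1 /content rowl_onerow !hornerE.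
  by rewrite /=; congr (_ ^+ _ - _ ^+ _); rewrite /onehalf; field.
- by exists (p + q) => t; rewrite hp hq hornerD.
by exists (p * q) => t; rewrite hp hq hornerM.
Qed.

(* On one-row diagrams an element of Lambda is a polynomial in the row length. *)
Lemma Lam_eq_nonempty (f g : fn) : inLam f -> inLam g ->
  (forall nu, (0 < ysize nu)%N -> f nu = g nu) -> f = g.
Proof.
move=> lf lg h; apply/funext => nu; case: (posnP (ysize nu)) => [e|]; last exact: h.
have [p hp] := Lam_onerow (inLam_sub lf lg).
have p0 : p = 0.
  by apply: poly_eq0_nat => n; rewrite -hp h ?ysize_onerow // subrr.
have -> : nu = onerow 0 by rewrite (ysize_eq0 e) [RHS]ysize_eq0 // ysize_onerow.
by apply/eqP; rewrite -subr_eq0 hp p0 horner0.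
Qed.

(** The defining relation leaves the value at the empty diagram open; [Lam_eq_nonempty] fixes it
    because the images lie in Lambda. *)
Lemma Dtilde_unique T1 T2 : @is_Dtilde R T1 -> @is_Dtilde R T2 ->
  forall f, inLam f -> T1 f = T2 f.
Proof.
move=> [[l1 _] h1] [[l2 _] h2] f lf.
apply: Lam_eq_nonempty; [exact: l1|exact: l2|move=> nu n0].
have e : ysize nu = (ysize nu).-1.+1 by rewrite prednK.
have := h1 _ _ lf _ e; rewrite (h2 _ _ lf _ e) => /mulfI; rewrite invr_eq0 pnatr_eq0.
by move=> /(_ isT).
Qed.

End DownOperator.

(** * The up operator *)

Section UpOperator.
Variable R : realType.
Local Notation fn := (ydiag -> R).
Variables z z' : R[i].

Lemma poch_arrow (w : R[i]) la nu : yarrow la nu ->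
  poch w nu la = w + ((csum R nu - csum R la)%:C)%C.
Proof.
move=> /yarrowP[k h]; rewrite (csum_addbox R h) /poch.
have hk : (k < size (rows nu))%N by rewrite -rowl_gt0 h eqxx addn1.
rewrite (iotaDl 1 0) big_map (bigD1_seq k) ?iota_uniq ?mem_iota //= [X in _ * X]big1 ?mulr1.
  rewrite !add1n !yrowS h eqxx addKn /= big_seq1 rmorphB !rmorph_nat /=.
  by rewrite -!natr1; ring.
move=> i ik; rewrite !add1n !yrowS h (negbTE ik) addn0 subnn big_nil //.
Qed.

Let A : R := complex.Re (z * z').
Definition upweight (c : R) : R :=
  A + c * (complex.Re z + complex.Re z') + c ^+ 2.

Lemma Re_poch la nu : yarrow la nu ->
  complex.Re (poch z nu la * poch z' nu la) = upweight (csum R nu - csum R la).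
Proof.
move=> h; rewrite !poch_arrow // /upweight /A; move: (_ - _) => c.
case: z z' => [a b] [a' b'] /=; ring.
Qed.

(** By [corner_sum], row [k] contributes the sum of the real parts of [z] and [z'], plus
    [2 (rowl la k - k) - 1]; the remaining [upweight (-N)] cancels everything except [A] and the row
    lengths. *)
Lemma upweight_corner la :
  \sum_(nu <- Yn (ysize la).+1 | yarrow la nu) upweight (csum R nu - csum R la)
  - \sum_(ka <- Yn (ysize la).-1 | yarrow ka la) upweight (csum R la - csum R ka)
  = A + 2 * (ysize la)%:R.
Proof.
set N := size (rows la).
rewrite (corner_sum _ (leqnn _)) -/N big_ord_recr /= addrAC -sumrB.
rewrite rowl_default // sub0r (ysizeE (leqnn _)) -/N natr_sum big_distrr /=.
have -> : upweight (- N%:R) = A - \sum_(k < N) ((complex.Re z + complex.Re z') - (2 * k%:R + 1)).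
  by rewrite sumrB sum_odd sumr_const card_ord -mulr_natl /upweight; ring.
rewrite addrCA -sumrB; congr (_ + _); apply: eq_bigr => k _; rewrite /upweight; ring.
Qed.

Lemma sum_Yn_delta n (P : pred ydiag) (F : ydiag -> R) a : ysize a = n ->
  \sum_(x <- Yn n | P x) F x * (x == a)%:R = if P a then F a else 0.
Proof.
move=> ha; rewrite big_mkcond (bigD1_seq a) ?uniq_Yn ?mem_Yn ?ha //= eqxx mulr1 big1 ?addr0 //.
by move=> x /negbTE ->; rewrite mulr0; case: ifP.
Qed.

(* The new box is commuted past the removed ones, one level at a time; each level
   [k] of the chains contributes [A + 2 k]. *)
Lemma upweight_dimr mu la : (ysize mu <= (ysize la).+1)%N ->
  \sum_(nu <- Yn (ysize la).+1 | yarrow la nu)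
     upweight (csum R nu - csum R la) * (dimr mu nu)%:R
  = \sum_(mub <- Yn (ysize mu).-1 | yarrow mub mu)
     upweight (csum R mu - csum R mub) * (dimr mub la)%:R
   + ((ysize la)%:R + 1 - (ysize mu)%:R) * (A + (ysize la)%:R + (ysize mu)%:R) * (dimr mu la)%:R.
Proof.
have [n] := ubnP (ysize la); elim: n la => // n IH la hn.
(* When [|mu| = |la| + 1], all [dimr] are Kronecker deltas and the last term has a zero factor. *)
rewrite leq_eqVlt => /predU1P[e|le].
  rewrite big_seq_cond (eq_bigr (fun nu => upweight (csum R nu - csum R la) * (nu == mu)%:R)); last first.
    by move=> nu /andP[]; rewrite mem_Yn -e => /eqP en _; rewrite dimr_eq // eq_sym.
  rewrite -big_seq_cond sum_Yn_delta //.
  rewrite [X in _ = X + _]big_seq_cond (eq_bigr (fun mub => upweight (csum R mu - csum R mub) * (mub == la)%:R)); last first.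
    by move=> nu /andP[]; rewrite mem_Yn e => /eqP en _; rewrite dimr_eq.
  rewrite -big_seq_cond sum_Yn_delta; last by rewrite e.
  by rewrite e -natr1 subrr !mul0r addr0.
set m := ysize mu in le *.
have -> : \sum_(nu <- Yn (ysize la).+1 | yarrow la nu) upweight (csum R nu - csum R la) * (dimr mu nu)%:R
  = \sum_(nu <- Yn (ysize la).+1 | yarrow la nu) \sum_(ka <- Yn (ysize la) | yarrow ka nu)
      upweight (csum R nu - csum R la) * (dimr mu ka)%:R.
  apply: eq_bigr => nu h; rewrite dimr_rec (yarrow_size h) // natr_sum big_distrr //.
rewrite (up_down_commute _ (fun ka => (dimr mu ka)%:R)) upweight_corner.
rewrite (eq_bigr (fun ka => \sum_(mub <- Yn m.-1 | yarrow mub mu)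
     upweight (csum R mu - csum R mub) * (dimr mub ka)%:R
   + ((ysize la)%:R - m%:R) * (A + (ysize la)%:R - 1 + m%:R) * (dimr mu ka)%:R)); last first.
  move=> ka h; have e := yarrow_size h; rewrite e IH; [|lia|rewrite -e; exact: le].
  by rewrite -natr1 -/m; ring.
rewrite big_split /= exchange_big /= -big_distrr /=.
rewrite (eq_bigr (fun mub => upweight (csum R mu - csum R mub) * (dimr mub la)%:R)); last first.
  move=> mub h; rewrite -big_distrr /= -natr_sum -dimr_rec //.
  by have := yarrow_size h; rewrite -/m; lia.
rewrite -addrA; congr (_ + _).
move: le; rewrite ltnS leq_eqVlt => /predU1P[e|lt].
  by rewrite e subrr !mul0r; ring.
by rewrite -natr_sum -dimr_rec //; ring.
Qed.

Hypothesis A_gt0 : 0 < A.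

Lemma A_nat_neq0 n : A + n%:R != 0.
Proof. by rewrite gt_eqF // ltr_wpDr // ler0n. Qed.

Definition Tup (f : fn) (la : ydiag) : R := (A + (ysize la)%:R) * Uop z z' (ysize la) f la.

Lemma TupE f la : Tup f la =
  \sum_(nu <- Yn (ysize la).+1 | yarrow la nu)
    upweight (csum R nu - csum R la) * (ydim nu)%:R / ((ysize la).+1%:R * (ydim la)%:R) * f nu.
Proof.
rewrite /Tup /Uop big_distrr [RHS]big_mkcond; apply: eq_bigr => nu _ /=.
rewrite /pup -/A; case: ifP => h; last by rewrite mul0r mulr0.
rewrite Re_poch // !mulrA; congr (_ * _ / _ * _).
by rewrite mulrAC divff ?mul1r ?A_nat_neq0.
Qed.

Lemma Tup_FS mu la : Tup (FS R mu) la =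
  \sum_(mub <- Yn (ysize mu).-1 | yarrow mub mu)
     complex.Re (poch z mu mub * poch z' mu mub) * FS R mub la
  + (pk R 1 la + A + (ysize mu)%:R) * FS R mu la.
Proof.
rewrite TupE pk1 [X in _ = X + _](eq_bigr (fun mub => upweight (csum R mu - csum R mub) * FS R mub la)); last first.
  by move=> mub h; rewrite Re_poch.
set n := ysize la; set m := ysize mu.
rewrite (eq_bigr (fun nu => ((n.+1 ^_ m)%:R / (n.+1%:R * (ydim la)%:R))
    * (upweight (csum R nu - csum R la) * (dimr mu nu)%:R))); last first.
  move=> nu h; rewrite /FS (yarrow_size h) -/n -/m.
  by field; rewrite !ydim_neq0 nat1r pnatr_eq0.
rewrite -big_distrr /=; case: (leqP m n.+1) => mn; last first.
  rewrite ffact_small // !mul0r FS_low ?mulr0 ?addr0; last by rewrite -/n -/m; lia.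
  rewrite big1 // => mub h; rewrite FS_low ?mulr0 //; have := yarrow_size h.
  by rewrite -/m -/n; lia.
rewrite upweight_dimr // -/n -/m mulrDr big_distrr /=; congr (_ + _).
  apply: eq_bigr => mub h; have e := yarrow_size h; rewrite /FS -/n /m e ffactSS natrM.
  by field; rewrite ydim_neq0 nat1r pnatr_eq0.
(* This absorbs the factor [n + 1 - m] from [upweight_dimr] into the falling factorial of
   [FS mu]. *)
have f2 : (n.+1 ^_ m)%:R * (n%:R + 1 - m%:R) = n.+1%:R * (n ^_ m)%:R :> R.
  by rewrite -natrM -ffactSS ffactnSr natrM natrB // -natr1.
rewrite /FS -/n -/m.
transitivity ((n.+1 ^_ m)%:R * (n%:R + 1 - m%:R) / (n.+1%:R * (ydim la)%:R) *
   (A + n%:R + m%:R) * (dimr mu la)%:R); first by ring.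
by rewrite f2; field; rewrite ydim_neq0 nat1r pnatr_eq0.
Qed.

Lemma Tup_lin a (f g : fn) la : Tup (fun x => a * f x + g x) la = a * Tup f la + Tup g la.
Proof.
rewrite !TupE big_distrr -big_split /=; apply: eq_bigr => nu _; ring.
Qed.

Lemma Lam_sum_seq (I : Type) (s : seq I) (P : pred I) (f : I -> fn) :
  (forall i, inLam (f i)) -> inLam (fun la => \sum_(i <- s | P i) f i la).
Proof.
move=> h; elim: s => [|i s IH].
  by rewrite (_ : (fun _ => _) = (fun _ => 0)); [exact: Lam_const | apply/funext => la; rewrite big_nil].
rewrite (_ : (fun _ => _) = (fun la => (if P i then f i la else 0) + \sum_(j <- s | P j) f j la)).
  by apply: Lam_add => //; case: (P i) => //; apply: Lam_const.
by apply/funext => la; rewrite big_cons; case: ifP => // _; rewrite add0r.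
Qed.

(** Stability is read off [Tup_FS] on the spanning functions [FS mu]. *)
Lemma Tup_inLam (f : fn) : inLam f -> inLam (Tup f).
Proof.
elim/Lam_FS_ind => [|c mu {}f lf].
  rewrite (_ : Tup _ = fun _ => 0); first exact: Lam_const.
  by apply/funext => la; rewrite TupE big1 // => nu _; rewrite mulr0.
rewrite (_ : Tup _ = fun la => c * Tup (FS R mu) la + Tup f la); last first.
  by apply/funext => la; rewrite Tup_lin.
apply: Lam_add lf; apply: inLam_scale; rewrite (funext (Tup_FS mu)); apply: Lam_add.
  by apply: Lam_sum_seq => mub; apply: inLam_scale; apply: FS_inLam.
apply: Lam_mul; last exact: FS_inLam.
apply: Lam_add; last exact: Lam_const.
by apply: Lam_add; [apply: Lam_p | apply: Lam_const].
Qed.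

Lemma is_Utilde_Tup : is_Utilde z z' Tup.
Proof.
split; first split.
- exact: Tup_inLam.
- by move=> a f g _ _; apply/funext => la; rewrite Tup_lin.
by move=> n f _ la e; rewrite /Tup e mulKf // A_nat_neq0.
Qed.

(** The case [n = 0] covers the empty diagram, so the relation determines [T f] pointwise, [A + n]
    being nonzero. *)
Lemma Utilde_unique T1 T2 : is_Utilde z z' T1 -> is_Utilde z z' T2 ->
  forall f, inLam f -> T1 f = T2 f.
Proof.
move=> [_ h1] [_ h2] f lf; apply/funext => la.
have := h1 _ _ lf la erefl; rewrite (h2 _ _ lf la erefl) => /mulfI -> //.
by rewrite invr_eq0 A_nat_neq0.
Qed.

End UpOperator.

(** In the principal series [z z'] is the squared modulus of [z]; in the complementary series both
    parameters lie between the same consecutive integers, hence on the same side of zero. *)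
Lemma admissible_gt0 (R : realType) (z z' : R[i]) :
  zz_admissible z z' -> 0 < complex.Re (z * z').
Proof.
case: z z' => [a b] [a' b'] [[/= b0 [-> ->]]|[N /= [-> [-> [/andP[h1 h2] /andP[h3 h4]]]]]].
  have b2 : 0 < b ^+ 2 by rewrite exprn_even_gt0.
  by have a2 := sqr_ge0 a; nra.
rewrite mul0r subr0; case: (lerP 0 N) => hN.
  have : (0 : R) <= N%:~R by rewrite ler0z.
  by move=> h; apply: mulr_gt0; lra.
have : ((N + 1)%:~R : R) <= 0 by rewrite lerz0; lia.
by move=> h; rewrite nmulr_rgt0; lra.
Qed.

Theorem theorem4p1 (R : realType) (z z' : R[i]) (hzz : zz_admissible z z') :
  (* (1) *)
  ((exists T, @is_Dtilde R T) /\
   (forall T1 T2, @is_Dtilde R T1 -> @is_Dtilde R T2 -> forall f, inLam f -> T1 f = T2 f) /\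
   (forall T, @is_Dtilde R T -> forall mu : ydiag,
      T (FS R mu) = (fun la => (pk R 1 la - (ysize mu)%:R) * FS R mu la)))
  /\
  (* (2) *)
  ((exists T, is_Utilde z z' T) /\
   (forall T1 T2, is_Utilde z z' T1 -> is_Utilde z z' T2 ->
      forall f, inLam f -> T1 f = T2 f) /\
   (forall T, is_Utilde z z' T -> forall mu : ydiag,
      T (FS R mu) = (fun la =>
        \sum_(mub <- Yn (ysize mu).-1 | yarrow mub mu)
           complex.Re (poch z mu mub * poch z' mu mub) * FS R mub la
        + (pk R 1 la + complex.Re (z * z') + (ysize mu)%:R) * FS R mu la))).
Proof.
split; (split; last split).
- by exists (@Tdown R); apply: is_Dtilde_Tdown.
- exact: Dtilde_unique.
- move=> T hT mu; rewrite (Dtilde_unique hT (is_Dtilde_Tdown R) (FS_inLam R mu)).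
  by apply/funext => la; rewrite Tdown_FS pk1.
- by exists (Tup z z'); apply: is_Utilde_Tup; apply: admissible_gt0.
- exact: (Utilde_unique (admissible_gt0 hzz)).
move=> T hT mu; have A0 := admissible_gt0 hzz.
rewrite (Utilde_unique A0 hT (is_Utilde_Tup A0) (FS_inLam R mu)).
by apply/funext => la; rewrite Tup_FS.
Qed.
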